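(* Let $p$ be a prime, $k$ a perfect field of characteristic $p$, $K$ a complete discretely valued extension of $\mathbb Q_p$ with ring of integers $\mathcal O_K$, residue field $k$ and ramification degree $e$, and let $r\ge0$ be an integer with $er<p-1$. Then the category $\mathrm{ModFI}^{r,\varphi}_{/\mathfrak S_\infty}$ is an abelian category.
   Context: $\mathfrak S=W(k)[[u]]$ with Frobenius $\varphi$ (Frobenius on $W(k)$, $u\mapsto u^p$); $E\in\mathfrak S$ is the Eisenstein polynomial of a fixed uniformizer of $\mathcal O_K$. The category $'\mathrm{Mod}^{r,\varphi}_{/\mathfrak S}$ has objects $\mathfrak S$-modules $\mathfrak M$ with a $\varphi$-semilinear endomorphism $\varphi:\mathfrak M\to\mathfrak M$ such that the cokernel of the linearization $\mathfrak S\otimes_{\varphi,\mathfrak S}\mathfrak M\to\mathfrak M$ is killed by $E^r$; morphisms are $\mathfrak S$-linear maps commuting with $\varphi$; a short sequence is exact if it is exact as $\mathfrak S$-modules. $\mathrm{Mod}^{r,\varphi}_{/\mathfrak S_1}$ is the full subcategory of objects which are finite free over $\mathfrak S/p=k[[u]]$. $\mathrm{Mod}^{r,\varphi}_{/\mathfrak S_\infty}$ is the smallest full subcategory of $'\mathrm{Mod}^{r,\varphi}_{/\mathfrak S}$ containing $\mathrm{Mod}^{r,\varphi}_{/\mathfrak S_1}$ and stable under extensions. $\mathrm{ModFI}^{r,\varphi}_{/\mathfrak S_\infty}$ is the full subcategory of $\mathrm{Mod}^{r,\varphi}_{/\mathfrak S_\infty}$ of objects isomorphic as $\mathfrak S$-modules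 to some $\bigoplus_{i=1}^n\mathfrak S/p^{a_i}$. *)

(* Defs.v *)
From HB Require Import structures.
From mathcomp Require Import all_boot all_order all_algebra.
From mathcomp Require Import boolp.

Set Implicit Arguments.
Unset Strict Implicit.
Unset Printing Implicit Defensive.

Import Order.TTheory GRing.Theory Num.Theory.
Local Open Scope ring_scope.

Record preadditive_category := PreadditiveCategory {
  ob :> Type;
  hom : ob -> ob -> zmodType;
  idm : forall X, hom X X;
  compm : forall X Y Z, hom Y Z -> hom X Y -> hom X Z;
  compA : forall X Y Z T (h : hom Z T) (g : hom Y Z) (f : hom X Y),
    compm h (compm g f) = compm (compm h g) f;
  comp1m : forall X Y (f : hom X Y), compm (idm Y) f = f;
  compm1 : forall X Y (f : hom X Y), compm f (idm X) = f;
  compDl : forall X Y Z (g g' : hom Y Z) (f : hom X Y),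
    compm (g + g') f = compm g f + compm g' f;
  compDr : forall X Y Z (g : hom Y Z) (f f' : hom X Y),
    compm g (f + f') = compm g f + compm g f'
}.

Section Abelian.
Variable C : preadditive_category.

Definition is_zero_object (Z : C) :=
  forall X : C, (forall f g : hom X Z, f = g) /\ (forall f g : hom Z X, f = g).

Definition is_biproduct (X Y B : C)
    (i1 : hom X B) (i2 : hom Y B) (p1 : hom B X) (p2 : hom B Y) :=
  [/\ compm p1 i1 = idm X, compm p2 i2 = idm Y,
      compm p1 i2 = 0, compm p2 i1 = 0
    & compm i1 p1 + compm i2 p2 = idm B].

Definition is_kernel (X Y N : C) (f : hom X Y) (i : hom N X) :=
  compm f i = 0 /\
  forall (T : C) (g : hom T X), compm f g = 0 ->
    exists! h : hom T N, compm i h = g.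

Definition is_cokernel (X Y Q : C) (f : hom X Y) (q : hom Y Q) :=
  compm q f = 0 /\
  forall (T : C) (g : hom Y T), compm g f = 0 ->
    exists! h : hom Q T, compm h q = g.

Definition is_mono (X Y : C) (f : hom X Y) :=
  forall (T : C) (g h : hom T X), compm f g = compm f h -> g = h.

Definition is_epi (X Y : C) (f : hom X Y) :=
  forall (T : C) (g h : hom Y T), compm g f = compm h f -> g = h.

Record abelian_category : Prop := AbelianCategory {
  abelian_zero : exists Z : C, is_zero_object Z;
  abelian_biproduct : forall X Y : C,
    exists (B : C) (i1 : hom X B) (i2 : hom Y B)
           (p1 : hom B X) (p2 : hom B Y), is_biproduct i1 i2 p1 p2;
  abelian_kernel : forall (X Y : C) (f : hom X Y),
    exists (N : C) (i : hom N X), is_kernel f i;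
  abelian_cokernel : forall (X Y : C) (f : hom X Y),
    exists (Q : C) (q : hom Y Q), is_cokernel f q;
  abelian_mono : forall (X Y : C) (f : hom X Y), is_mono f ->
    exists (Z : C) (g : hom Y Z), is_kernel g f;
  abelian_epi : forall (X Y : C) (f : hom X Y), is_epi f ->
    exists (Z : C) (g : hom Z X), is_cokernel g f
}.

Definition full_subcategory (P : C -> Prop) : preadditive_category :=
  @PreadditiveCategory {X : C | P X}
    (fun X Y => hom (sval X) (sval Y))
    (fun X => idm (sval X))
    (fun X Y Z g f => compm g f)
    (fun X Y Z T h g f => compA h g f)
    (fun X Y f => comp1m f)
    (fun X Y f => compm1 f)
    (fun X Y Z g g' f => compDl g g' f)
    (fun X Y Z g f f' => compDr g f f').

End Abelian.

Record fps (R : Type) := FPS { fcoef : nat -> R }.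

HB.instance Definition _ (R : Type) := gen_eqMixin (fps R).
HB.instance Definition _ (R : Type) := gen_choiceMixin (fps R).

Section FPS.
Variable R : comNzRingType.
Implicit Types f g h : fps R.

Lemma fpsP f g : (forall n, fcoef f n = fcoef g n) -> f = g.
Proof. by case: f g => [f] [g] /= /funext ->. Qed.

Definition fps0 : fps R := FPS (fun=> 0).
Definition fps1 : fps R := FPS (fun n => (n == 0%N)%:R).
Definition fps_opp f : fps R := FPS (fun n => - fcoef f n).
Definition fps_add f g : fps R := FPS (fun n => fcoef f n + fcoef g n).
Definition fps_mul f g : fps R :=
  FPS (fun n => \sum_(i < n.+1) fcoef f i * fcoef g (n - i)).

Fact fps_addA : associative fps_add.
Proof. by move=> f g h; apply: fpsP => n /=; rewrite addrA. Qed.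
Fact fps_addC : commutative fps_add.
Proof. by move=> f g; apply: fpsP => n /=; rewrite addrC. Qed.
Fact fps_add0 : left_id fps0 fps_add.
Proof. by move=> f; apply: fpsP => n /=; rewrite add0r. Qed.
Fact fps_addN : left_inverse fps0 fps_opp fps_add.
Proof. by move=> f; apply: fpsP => n /=; rewrite addNr. Qed.

HB.instance Definition _ := GRing.isZmodule.Build (fps R)
  fps_addA fps_addC fps_add0 fps_addN.

Definition fps_trunc n f : {poly R} := \poly_(i < n) fcoef f i.

Lemma coef_fps_trunc n f i : (i < n)%N -> (fps_trunc n f)`_i = fcoef f i.
Proof. by move=> lt_in; rewrite coef_poly lt_in. Qed.

Lemma fps_mul_trunc n f g i : (i < n)%N ->
  fcoef (fps_mul f g) i = (fps_trunc n f * fps_trunc n g)`_i.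
Proof.
move=> lt_in; rewrite coefM /=; apply: eq_bigr => j _.
rewrite !coef_fps_trunc //; first exact: leq_ltn_trans (leq_subr _ _) lt_in.
by apply: leq_trans lt_in; apply: ltn_ord.
Qed.

Fact fps_mulC : commutative fps_mul.
Proof.
by move=> f g; apply: fpsP => n; rewrite !(@fps_mul_trunc n.+1) // mulrC.
Qed.

Fact fps_mulA : associative fps_mul.
Proof.
move=> f g h; apply: fpsP => n.
transitivity ((fps_trunc n.+1 f * (fps_trunc n.+1 g * fps_trunc n.+1 h))`_n).
  rewrite coefM; apply: eq_bigr => j _.
  by rewrite coef_fps_trunc // (@fps_mul_trunc n.+1) // ltnS leq_subr.
rewrite mulrA coefM; apply: eq_bigr => j _.
by rewrite coef_fps_trunc ?ltnS ?leq_subr // (@fps_mul_trunc n.+1).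
Qed.

Fact fps_mul1 : left_id fps1 fps_mul.
Proof.
move=> f; apply: fpsP => n /=; rewrite big_ord_recl /= mul1r subn0 big1 ?addr0 //.
by move=> i _; rewrite mul0r.
Qed.

Fact fps_mulDl : left_distributive fps_mul fps_add.
Proof.
move=> f g h; apply: fpsP => n /=; rewrite -big_split /=.
by apply: eq_bigr => i _; rewrite mulrDl.
Qed.

Fact fps_1neq0 : fps1 != fps0.
Proof.
by apply/eqP => /(congr1 (fun f => fcoef f 0)) /= /eqP; rewrite oner_eq0.
Qed.

HB.instance Definition _ := GRing.Zmodule_isComNzRing.Build (fps R)
  fps_mulA fps_mulC fps_mul1 fps_mulDl fps_1neq0.

Definition fps_of_poly (P : {poly R}) : fps R := FPS (fun n => P`_n).

End FPS.

(* The endomorphism sum_n a_n u^n |-> sum_n sigma(a_n) u^(p n). *)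
Section Frobenius.
Variables (p : nat) (W : comNzRingType) (sigma : {rmorphism W -> W}).

Definition fps_frob (f : fps W) : fps W :=
  FPS (fun n => if (p %| n)%N then sigma (fcoef f (n %/ p)%N) else 0).

Fact fps_frob_is_zmod_morphism : zmod_morphism fps_frob.
Proof.
move=> f g; apply: fpsP => n /=.
by case: ifP => _; rewrite ?subr0 // rmorphB.
Qed.

Fact fps_frob_is_monoid_morphism : monoid_morphism fps_frob.
Proof.
split=> [|f g]; apply: fpsP => n /=.
  case: ifPn => [/dvdnP[q ->]|pn].
    case: (posnP p) => [->|p_gt0]; first by rewrite !muln0 divn0 rmorph1.
    rewrite mulnK // muln_eq0 (gtn_eqF p_gt0) orbF.
    by case: (q == 0%N); rewrite ?rmorph1 ?rmorph0.
  by case: eqP pn => // ->; rewrite dvdn0.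
case: ifPn => [/dvdnP[q ->]|pn]; last first.
  rewrite big1 // => i _; case: ifPn => [pi|_]; last by rewrite mul0r.
  case: ifPn => [pni|_]; last by rewrite mulr0.
  case/negP: pn; rewrite -(subnKC (ltn_ord i : i <= n)%N).
  exact: dvdn_add.
case: (posnP p) => [->|p_gt0].
  rewrite muln0 divn0 !big_ord_recl !big_ord0 /= !addr0.
  by rewrite rmorphM.
rewrite mulnK // rmorph_sum /=.
pose F i := sigma (fcoef f i * fcoef g (q - i)).
pose G i := (if (p %| i)%N then sigma (fcoef f (i %/ p)) else 0) *
  (if (p %| q * p - i)%N then sigma (fcoef g ((q * p - i) %/ p)) else 0).
rewrite -(big_mkord xpredT F) -(big_mkord xpredT G).
suff sumE m : (m <= q)%N ->
    \sum_(0 <= i < m.+1) F i = \sum_(0 <= i < (m * p).+1) G i by exact: sumE.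
elim: m => [|m IHm] le_mq.
  rewrite mul0n !big_nat1 /F /G dvdn0 !subn0 dvdn_mull // div0n mulnK //.
  by rewrite rmorphM.
rewrite big_nat_recr //= IHm ?(ltnW le_mq) //.
have lt_mp : (m * p < m.+1 * p)%N by rewrite ltn_pmul2r.
rewrite [RHS]big_nat_recr // (big_cat_nat (leq0n (m * p).+1) lt_mp) /=.
rewrite [X in _ + X + _]big_nat_cond [X in _ + X + _]big1; last first.
  move=> i /andP[/andP[lo hi] _].
  rewrite /G; case: ifP => [/dvdnP[c def_i]|_]; last by rewrite mul0r.
  move: lo hi; rewrite def_i !ltn_pmul2r // => lt_mc.
  by rewrite ltnS leqNgt lt_mc.
rewrite addr0 /F /G dvdn_mull // mulnK // -mulnBl dvdn_mull // mulnK //.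
by rewrite rmorphM.
Qed.

HB.instance Definition _ :=
  GRing.isZmodMorphism.Build (fps W) (fps W) fps_frob fps_frob_is_zmod_morphism.
HB.instance Definition _ :=
  GRing.isMonoidMorphism.Build (fps W) (fps W) fps_frob
    fps_frob_is_monoid_morphism.

End Frobenius.

Section Cyclic.
Variables (S : comNzRingType) (c : S).

Definition multiples : {pred S} := fun x => `[< exists y, x = c * y >].

Fact multiples_zmod_closed : zmod_closed multiples.
Proof.
split=> [|x y /asboolP[a ->] /asboolP[b ->]]; apply/asboolP.
  by exists 0; rewrite mulr0.
by exists (a - b); rewrite mulrBr.
Qed.

HB.instance Definition _ :=
  GRing.isZmodClosed.Build S multiples multiples_zmod_closed.

Definition cyclic_module := Quotient.quot (multiples : zmodClosed S).

HB.instance Definition _ := GRing.Zmodule.on cyclic_module.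

Local Open Scope quotient_scope.

Definition cyclic_pi (x : S) : cyclic_module := \pi_(cyclic_module) x.

Lemma cyclic_piP (x : cyclic_module) : exists y, x = cyclic_pi y.
Proof. by exists (repr x); rewrite /cyclic_pi reprK. Qed.

Lemma cyclic_piD x y : cyclic_pi (x + y) = cyclic_pi x + cyclic_pi y.
Proof. exact: raddfD. Qed.

Lemma cyclic_pi_eq x y : cyclic_pi x = cyclic_pi y <-> exists z, x - y = c * z.
Proof.
split=> [/eqP|xy]; first by rewrite -Quotient.idealrBE => /asboolP.
by apply/eqP; rewrite -Quotient.idealrBE; apply/asboolP.
Qed.

Definition cyclic_scale (s : S) (x : cyclic_module) : cyclic_module :=
  cyclic_pi (s * repr x).

Lemma cyclic_scale_pi s x : cyclic_scale s (cyclic_pi x) = cyclic_pi (s * x).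
Proof.
have /cyclic_pi_eq[y xy] : cyclic_pi (repr (cyclic_pi x)) = cyclic_pi x.
  by rewrite /cyclic_pi reprK.
by apply/cyclic_pi_eq; exists (s * y); rewrite -mulrBr xy mulrCA.
Qed.

Fact cyclic_scaleA a b x :
  cyclic_scale a (cyclic_scale b x) = cyclic_scale (a * b) x.
Proof. by have [y ->] := cyclic_piP x; rewrite !cyclic_scale_pi mulrA. Qed.

Fact cyclic_scale1 : left_id 1 cyclic_scale.
Proof. by move=> x; have [y ->] := cyclic_piP x; rewrite cyclic_scale_pi mul1r. Qed.

Fact cyclic_scaleDr : right_distributive cyclic_scale +%R.
Proof.
move=> a x y; have [x' ->] := cyclic_piP x; have [y' ->] := cyclic_piP y.
by rewrite -cyclic_piD !cyclic_scale_pi mulrDr cyclic_piD.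
Qed.

Fact cyclic_scaleDl x : {morph cyclic_scale^~ x : a b / a + b}.
Proof.
move=> a b; have [y ->] := cyclic_piP x.
by rewrite !cyclic_scale_pi mulrDl cyclic_piD.
Qed.

HB.instance Definition _ := GRing.Zmodule_isLmodule.Build S cyclic_module
  cyclic_scaleA cyclic_scale1 cyclic_scaleDr cyclic_scaleDl.

End Cyclic.

Section Modules.
Variable S : comNzRingType.

Fixpoint direct_sum (Ms : seq (lmodType S)) : lmodType S :=
  if Ms is M :: Ms' then (M * direct_sum Ms')%type else 'rV[S]_0.

Definition lmod_iso (M N : lmodType S) : Prop :=
  exists f : {linear M -> N}, bijective f.

End Modules.

Section PhiModules.
Variables (S : comNzRingType) (frob : {rmorphism S -> S}) (E : S) (r : nat).

(* Elements of the tensor product of S and M over frob are finite sums of pure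
   tensors s (x) m, and the linearization of phi sends s (x) m to s *: phi m. *)
Definition linearization_image (M : lmodType S) (phi : M -> M) (x : M) : Prop :=
  exists t : seq (S * M), x = \sum_(sm <- t) sm.1 *: phi sm.2.

Record phimod := PhiMod {
  phimod_sort :> lmodType S;
  phi : {linear phimod_sort -> phimod_sort | frob \; *:%R};
  phi_height : forall x, linearization_image phi (E ^+ r *: x)
}.

Record phihom (M N : phimod) := PhiHom {
  phihom_fun :> M -> N;
  phihom_linear : linear phihom_fun;
  phihom_comm : forall x, phihom_fun (phi M x) = phi N (phihom_fun x)
}.

HB.instance Definition _ M N := gen_eqMixin (phihom M N).
HB.instance Definition _ M N := gen_choiceMixin (phihom M N).
HB.instance Definition _ M N (f : phihom M N) :=
  GRing.isLinear.Build S M N *:%R f (phihom_linear f).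

Lemma phihomP M N (f g : phihom M N) : f =1 g -> f = g.
Proof.
case: f g => [f fl fc] [g gl gc] /= /funext eq_fg.
by case: _ / eq_fg in gl gc *; congr PhiHom; apply: Prop_irrelevance.
Qed.

Section HomZmod.
Variables M N : phimod.
Implicit Types f g h : phihom M N.

Definition phihom_zero : phihom M N.
Proof.
exists (fun=> 0) => [a x y|x]; first by rewrite scaler0 addr0.
by rewrite raddf0.
Defined.

Definition phihom_opp f : phihom M N.
Proof.
exists (fun x => - f x) => [a x y|x].
  by rewrite linearP opprD scalerN.
by rewrite raddfN phihom_comm.
Defined.

Definition phihom_add f g : phihom M N.
Proof.
exists (fun x => f x + g x) => [a x y|x].
  by rewrite !linearP scalerDr addrACA.
by rewrite raddfD !phihom_comm.
Defined.

Fact phihom_addA : associative phihom_add.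
Proof. by move=> f g h; apply: phihomP => x /=; rewrite addrA. Qed.
Fact phihom_addC : commutative phihom_add.
Proof. by move=> f g; apply: phihomP => x /=; rewrite addrC. Qed.
Fact phihom_add0 : left_id phihom_zero phihom_add.
Proof. by move=> f; apply: phihomP => x /=; rewrite add0r. Qed.
Fact phihom_addN : left_inverse phihom_zero phihom_opp phihom_add.
Proof. by move=> f; apply: phihomP => x /=; rewrite addNr. Qed.

HB.instance Definition _ := GRing.isZmodule.Build (phihom M N)
  phihom_addA phihom_addC phihom_add0 phihom_addN.

End HomZmod.

Definition phihom_id M : phihom M M.
Proof. by exists id. Defined.

Definition phihom_comp M N P (g : phihom N P) (f : phihom M N) : phihom M P.
Proof.
exists (g \o f) => [a x y|x] /=; first by rewrite !linearP.
by rewrite !phihom_comm.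
Defined.

Definition phimod_category : preadditive_category.
Proof.
apply: (@PreadditiveCategory phimod (fun M N => phihom M N : zmodType)
  phihom_id phihom_comp) => [M N P Q h g f|M N f|M N f|M N P g g' f|M N P g f f'];
  apply: phihomP => x //=.
exact: raddfD.
Defined.

Definition short_exact (M' M M'' : phimod)
    (f : phihom M' M) (g : phihom M M'') : Prop :=
  [/\ injective f, forall z, exists y, g y = z
    & forall y, g y = 0 <-> exists x, f x = y].

Variable p : nat.

Definition quot_pow (a : nat) : lmodType S := cyclic_module (p%:R ^+ a : S).

Definition Mod_S1 (M : phimod) : Prop :=
  exists n : nat, lmod_iso M (direct_sum (nseq n (quot_pow 1))).

Inductive Mod_Sinf : phimod -> Prop :=
| Mod_Sinf_base M : Mod_S1 M -> Mod_Sinf M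
| Mod_Sinf_ext M' M M'' (f : phihom M' M) (g : phihom M M'') :
    short_exact f g -> Mod_Sinf M' -> Mod_Sinf M'' -> Mod_Sinf M.

Definition ModFI_Sinf (M : phimod) : Prop :=
  Mod_Sinf M /\
  exists a : seq nat, lmod_iso M (direct_sum [seq quot_pow i | i <- a]).

Definition ModFI_category : preadditive_category :=
  @full_subcategory phimod_category ModFI_Sinf.

End PhiModules.

(* The value of v at 0 is irrelevant: 0 has valuation +oo in [vge]. *)
Record discrete_valuation (K : fieldType) := DiscreteValuation {
  dv :> K -> int;
  dvM : forall x y, x != 0 -> y != 0 -> dv (x * y) = dv x + dv y;
  dvD : forall x y, x != 0 -> y != 0 -> x + y != 0 ->
    Num.min (dv x) (dv y) <= dv (x + y);
  dv_normalized : exists x, x != 0 /\ dv x = 1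
}.

Section Valuation.
Variables (K : fieldType) (v : discrete_valuation K).

Definition vge (n : int) (x : K) : bool := (x == 0) || (n <= v x).

Definition complete_valuation : Prop :=
  forall x : nat -> K,
    (forall n : int, exists m, forall i j,
       (m <= i)%N -> (m <= j)%N -> vge n (x i - x j)) ->
    exists l, forall n : int, exists m, forall i,
       (m <= i)%N -> vge n (x i - l).

Definition integer_pred : {pred K} := vge 0.

Lemma dv1 : v 1 = 0.
Proof.
have := dvM v (oner_neq0 K) (oner_neq0 K); rewrite mulr1 => /eqP.
by rewrite -subr_eq subrr eq_sym => /eqP.
Qed.

Lemma dvN1 : v (-1) = 0.
Proof.
have n1 : (-1 : K) != 0 by rewrite oppr_eq0 oner_neq0.
have := dvM v n1 n1; rewrite mulrNN mulr1 dv1 -mulr2n => /eqP.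
by rewrite eq_sym mulrn_eq0 /= => /eqP.
Qed.

Fact integer_subring_closed : subring_closed integer_pred.
Proof.
have mul : {in integer_pred &, forall x y, x * y \in integer_pred}.
  move=> x y; rewrite !unfold_in /vge.
  have [->|x0] := eqVneq x 0; first by rewrite mul0r eqxx.
  have [->|y0] := eqVneq y 0; first by rewrite mulr0 eqxx.
  by move=> vx vy; rewrite dvM // addr_ge0 ?orbT.
split=> [||//]; first by rewrite unfold_in /vge dv1 lexx orbT.
move=> x y Ox Oy; rewrite -mulN1r.
have {Oy} : -1 * y \in integer_pred.
  by apply: mul => //; rewrite unfold_in /vge dvN1 lexx orbT.
move: (-1 * y) Ox => {}y; rewrite !unfold_in /vge.
have [->|x0] := eqVneq x 0; first by rewrite add0r.
have [->|y0] := eqVneq y 0; first by rewrite addr0 (negPf x0).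
have [//|xy0] := eqVneq (x + y) 0; move=> /= vx vy.
by apply: le_trans (dvD v x0 y0 xy0); rewrite le_min vx.
Qed.

HB.instance Definition _ :=
  GRing.isSubringClosed.Build K integer_pred integer_subring_closed.

Record integers := Integers {
  integer_val :> K;
  integer_valP : integer_val \in integer_pred
}.

HB.instance Definition _ := [isSub for integer_val].
HB.instance Definition _ := [Choice of integers by <:].
HB.instance Definition _ := [SubChoice_isSubComNzRing of integers by <:].

Definition is_residue_map (k : fieldType) (res : {rmorphism integers -> k}) :=
  (forall y, exists x, res x = y) /\
  (forall x, res x = 0 <-> vge 1 (integer_val x)).

Definition uniformizer (x : integers) : Prop :=
  integer_val x != 0 /\ v (integer_val x) = 1.

End Valuation.

Definition perfect_field (p : nat) (k : fieldType) : Prop :=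
  p \in [pchar k] /\ forall x : k, exists y, y ^+ p = x.

Definition divides (R : comNzRingType) (a b : R) : Prop := exists c, b = a * c.

(* For k perfect of characteristic p, W(k) is the strict p-ring with residue
   ring k: p-torsion free, p-adically separated and complete, with W / p
   identified with k by [red]; it is unique up to unique isomorphism (Serre,
   Local Fields, II.5-6). *)
Record is_witt_ring (p : nat) (k : fieldType) (W : comNzRingType)
    (red : {rmorphism W -> k}) : Prop := IsWittRing {
  witt_red_surj : forall y, exists x, red x = y;
  witt_red_ker : forall x, red x = 0 <-> divides p%:R x;
  witt_torsion_free : forall x : W, p%:R * x = 0 -> x = 0;
  witt_separated : forall x : W, (forall n, divides (p%:R ^+ n) x) -> x = 0;
  witt_complete : forall x : nat -> W,
    (forall n, divides (p%:R ^+ n) (x n.+1 - x n)) ->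
    exists l, forall n, divides (p%:R ^+ n) (x n - l)
}.

(* The Frobenius of W(k) is its unique ring endomorphism lifting y |-> y ^+ p. *)
Definition is_witt_frobenius (p : nat) (k : fieldType) (W : comNzRingType)
    (red : {rmorphism W -> k}) (sigma : {rmorphism W -> W}) : Prop :=
  forall x, red (sigma x) = red x ^+ p.

Record is_eisenstein (p : nat) (W : comNzRingType) (E : {poly W}) : Prop :=
  IsEisenstein {
  eisenstein_monic : E \is monic;
  eisenstein_size : (1 < size E)%N;
  eisenstein_coef : forall i, (i < (size E).-1)%N -> divides p%:R E`_i;
  eisenstein_coef0 : ~ divides (p%:R ^+ 2) E`_0
}.

(* Main.v *)
Require Import Defs.
From HB Require Import structures.
From mathcomp Require Import all_boot all_order all_algebra.
From mathcomp Require Import boolp.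
Set Implicit Arguments.
Unset Strict Implicit.
Unset Printing Implicit Defensive.
Import Order.TTheory GRing.Theory Num.Theory.
Local Open Scope ring_scope.

(** Membership in Mod_Sinf is automatic for a module M of the form (+) S/p^a_i,
    because p M and M/pM inherit the height condition. Such M are characterised
    as the finitely generated modules killed by a power of p for which every
    M/p^n M has no u-torsion, so one has to control the u-torsion of kernels
    and cokernels.

    Since S is free over frob(S) on 1, u, ..., u^(p-1), the elements of the
    span of phi(M) are the sums of u^i phi(z_i) with i < p, and the z_i are
    unique because the matrix of phi on a quotient killed by p divides a power
    of u. Hence kernels inherit the height condition. Let D be a
    phi-submodule of height r of such a module Q killed by p, and let u^n be the
    least power killing the u-torsion of Q/D. For y torsion modulo D,
    u^(n+er) phi(y) lies in the span of phi(D); if n + er = pq + t with t < p,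
    uniqueness gives u^q y in D, so n <= q and n (p - 1) <= er < p - 1, that is
    n = 0. Applied to the graded pieces of the p-adic filtration, this shows
    that kernels and cokernels computed in modules stay in the category. *)

(** * Submodules and quotients *)

Record submod (S : comNzRingType) (M : lmodType S) := Submod {
  submod_pred :> M -> Prop;
  submod0 : submod_pred 0;
  submodZD : forall a x y,
    submod_pred x -> submod_pred y -> submod_pred (a *: x + y)
}.

Section Submodules.
Variables (S : comNzRingType) (M : lmodType S).
Implicit Types (P Q : submod M) (x y : M).

Lemma submodD P x y : P x -> P y -> P (x + y).
Proof. by rewrite -[x in P (x + _)]scale1r; apply: submodZD. Qed.

Lemma submodZ P a x : P x -> P (a *: x).
Proof. by move=> Px; rewrite -[_ *: _]addr0; apply: submodZD (submod0 P). Qed.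

Lemma submodN P x : P x -> P (- x).
Proof. by rewrite -scaleN1r; apply: submodZ. Qed.

Lemma submodB P x y : P x -> P y -> P (x - y).
Proof. by move=> Px /submodN; apply: submodD. Qed.

Lemma submod_addr P x y : P y -> P (x + y) -> P x.
Proof. by move=> Py Pxy; rewrite -(addrK y x); apply: submodB. Qed.

Lemma submod_sum P (I : Type) (s : seq I) (F : I -> M) :
  (forall i, P (F i)) -> P (\sum_(i <- s) F i).
Proof.
move=> PF; elim: s => [|i s IHs]; first by rewrite big_nil; apply: submod0.
by rewrite big_cons; apply: submodD.
Qed.

Definition topmod : submod M.
Proof. by exists (fun=> True). Defined.

Definition zeromod : submod M.
Proof. by exists (fun x => x = 0) => // a x y -> ->; rewrite scaler0 addr0. Defined.

Definition linemod x : submod M.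
Proof.
exists (fun y => exists s, y = s *: x) => [|a y z [s ->] [t ->]].
  by exists 0; rewrite scale0r.
by exists (a * s + t); rewrite scalerDl scalerA.
Defined.

Definition addmod P Q : submod M.
Proof.
exists (fun x => exists2 y, P y & Q (x - y)) => [|a x y [x' Px' Qx'] [y' Py' Qy']].
  by exists 0; rewrite ?subr0; apply: submod0.
exists (a *: x' + y'); first exact: submodZD.
by rewrite opprD addrACA -scalerBr; apply: submodZD.
Defined.

Definition capmod P Q : submod M.
Proof.
exists (fun x => P x /\ Q x) => [|a x y [Px Qx] [Py Qy]].
  by split; apply: submod0.
by split; apply: submodZD.
Defined.

Definition multmod (c : S) : submod M.
Proof.
exists (fun x => exists y, x = c *: y) => [|a x y [x' ->] [y' ->]].
  by exists 0; rewrite scaler0.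
by exists (a *: x' + y'); rewrite scalerDr !scalerA mulrC.
Defined.

Definition colonmod (P : submod M) (c : S) : submod M.
Proof.
exists (fun x => P (c *: x)) => [|a x y Px Py].
  by rewrite scaler0; apply: submod0.
by rewrite scalerDr scalerA mulrC -scalerA; apply: submodZD.
Defined.

Definition satmod (P : submod M) (u : S) : submod M.
Proof.
exists (fun x => exists n, P (u ^+ n *: x)) => [|a x y [m Px] [n Py]].
  by exists 0%N; rewrite scaler0; apply: submod0.
exists (m + n)%N; rewrite scalerDr; apply: submodD.
  rewrite scalerA mulrC -scalerA addnC exprD -scalerA.
  by do 2!apply: submodZ.
by rewrite exprD -scalerA; apply: submodZ.
Defined.

Definition seqspan (es : seq M) : submod M :=
  foldr (fun e P => addmod (linemod e) P) zeromod es.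

Lemma addmodl P Q x : P x -> addmod P Q x.
Proof. by move=> Px; exists x; rewrite // subrr; apply: submod0. Qed.

Lemma addmodr P Q x : Q x -> addmod P Q x.
Proof. by move=> Qx; exists 0; rewrite ?subr0 //; apply: submod0. Qed.

Lemma linemod_id x : linemod x x.
Proof. by exists 1; rewrite scale1r. Qed.

Lemma seqspan_mem es e : e \in es -> seqspan es e.
Proof.
elim: es => // e' es IHes; rewrite inE => /predU1P[->|/IHes]; last exact: addmodr.
exact/addmodl/linemod_id.
Qed.

Lemma seqspan_min es P : (forall e, e \in es -> P e) ->
  forall x, seqspan es x -> P x.
Proof.
elim: es => [_ x ->|e es IHes Pes x [y [s ->] span_xy]]; first exact: submod0.
rewrite -(subrK (s *: e) x); apply: submodD.
  by apply: IHes span_xy => e' es_e'; apply: Pes; rewrite inE es_e' orbT.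
by apply: submodZ; apply: Pes; rewrite mem_head.
Qed.

Lemma seqspan_coef es x : seqspan es x ->
  exists s : 'I_(size es) -> S, x = \sum_i s i *: nth 0 es i.
Proof.
elim: es x => [x ->|e es IHes x [y [s ->] /IHes[t xE]]].
  by exists (fun=> 0); rewrite big_ord0.
exists (fun i => oapp t s (unlift ord0 i)).
rewrite big_ord_recl /= unlift_none /=; under eq_bigr do rewrite liftK.
by rewrite -xE addrC subrK.
Qed.

End Submodules.

Arguments topmod {S M}.
Arguments zeromod {S M}.

Definition preimmod (S : comNzRingType) (M N : lmodType S) (f : {linear M -> N})
  (P : submod N) : submod M.
Proof.
exists (fun x => P (f x)) => [|a x y Px Py]; first by rewrite raddf0; apply: submod0.
by rewrite linearP; apply: submodZD.
Defined.

Definition imagemod (S : comNzRingType) (M N : lmodType S) (f : {linear M -> N}) :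
  submod N.
Proof.
exists (fun y => exists x, y = f x) => [|a y z [x ->] [x' ->]].
  by exists 0; rewrite raddf0.
by exists (a *: x + x'); rewrite linearP.
Defined.

Definition pushmod (S : comNzRingType) (M N : lmodType S) (f : {linear M -> N})
  (P : submod M) : submod N.
Proof.
exists (fun y => exists2 x, P x & y = f x) => [|a y z [x Px ->] [x' Px' ->]].
  by exists 0; [apply: submod0 | rewrite raddf0].
by exists (a *: x + x'); [apply: submodZD | rewrite linearP].
Defined.

Section Quotient.
Variables (S : comNzRingType) (M : lmodType S) (P : submod M).

Definition submod_mem : {pred M} := fun x => `[< P x >].

Lemma submod_memP x : reflect (P x) (x \in submod_mem).
Proof. exact: asboolP. Qed.

Fact submod_mem_closed : submod_closed submod_mem.
Proof.
split=> [|a x y /submod_memP Px /submod_memP Py]; apply/submod_memP.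
  exact: submod0.
exact: submodZD.
Qed.

HB.instance Definition _ :=
  GRing.isSubmodClosed.Build S M submod_mem submod_mem_closed.

Definition quotmod := Quotient.quot (submod_mem : zmodClosed M).

HB.instance Definition _ := GRing.Zmodule.on quotmod.

Local Open Scope quotient_scope.

Definition quot_pi (x : M) : quotmod := \pi_quotmod x.

Lemma quot_pi_repr (x : quotmod) : quot_pi (repr x) = x.
Proof. exact: reprK. Qed.

Lemma quot_pi_surj (x : quotmod) : exists y, x = quot_pi y.
Proof. by exists (repr x); rewrite quot_pi_repr. Qed.

Fact quot_piD x y : quot_pi (x + y) = quot_pi x + quot_pi y.
Proof. exact: raddfD. Qed.

Lemma quot_pi_eq x y : quot_pi x = quot_pi y <-> P (x - y).
Proof.
split=> [/eqP|Pxy]; first by rewrite -Quotient.idealrBE => /submod_memP.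
by apply/eqP; rewrite -Quotient.idealrBE; apply/submod_memP.
Qed.

Definition quot_scale (s : S) (x : quotmod) : quotmod := quot_pi (s *: repr x).

Fact quot_scale_pi s x : quot_scale s (quot_pi x) = quot_pi (s *: x).
Proof.
by apply/quot_pi_eq; rewrite -scalerBr; apply: submodZ; apply/quot_pi_eq/quot_pi_repr.
Qed.

Fact quot_scaleA a b x : quot_scale a (quot_scale b x) = quot_scale (a * b) x.
Proof. by have [y ->] := quot_pi_surj x; rewrite !quot_scale_pi scalerA. Qed.

Fact quot_scale1 : left_id 1 quot_scale.
Proof. by move=> x; have [y ->] := quot_pi_surj x; rewrite quot_scale_pi scale1r. Qed.

Fact quot_scaleDr : right_distributive quot_scale +%R.
Proof.
move=> a x y; have [x' ->] := quot_pi_surj x; have [y' ->] := quot_pi_surj y.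
by rewrite -quot_piD !quot_scale_pi scalerDr quot_piD.
Qed.

Fact quot_scaleDl x : {morph quot_scale^~ x : a b / a + b}.
Proof.
move=> a b; have [y ->] := quot_pi_surj x.
by rewrite !quot_scale_pi scalerDl quot_piD.
Qed.

HB.instance Definition _ := GRing.Zmodule_isLmodule.Build S quotmod
  quot_scaleA quot_scale1 quot_scaleDr quot_scaleDl.

Fact quot_pi_linear : linear quot_pi.
Proof. by move=> a x y; rewrite quot_piD -quot_scale_pi. Qed.

HB.instance Definition _ :=
  GRing.isLinear.Build S M quotmod *:%R quot_pi quot_pi_linear.

Lemma quot_pi0 x : quot_pi x = 0 <-> P x.
Proof. by rewrite -(raddf0 quot_pi) quot_pi_eq subr0. Qed.

Record submod_type := SubmodType {
  submod_val :> M;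
  submod_valP : submod_val \in submod_mem
}.

HB.instance Definition _ := [isSub for submod_val].
HB.instance Definition _ := [Choice of submod_type by <:].
HB.instance Definition _ := [SubChoice_isSubLmodule of submod_type by <:].

Definition mk_sub x (Px : P x) : submod_type :=
  SubmodType (introT (submod_memP x) Px).

Lemma submod_val_in (x : submod_type) : P (submod_val x).
Proof. exact/submod_memP/submod_valP. Qed.

End Quotient.

Section FrobeniusModules.
Variables (S : comNzRingType) (frob : {rmorphism S -> S}) (E : S) (r : nat).
Notation phimod := (phimod frob E r).

Section QuotientPhi.
Variables (X : phimod) (P : submod X).
Hypothesis P_phi : forall x, P x -> P (phi X x).

Definition quot_phi (x : quotmod P) : quotmod P := quot_pi P (phi X (repr x)).

Lemma quot_phi_pi x : quot_phi (quot_pi P x) = quot_pi P (phi X x).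
Proof.
apply/quot_pi_eq; rewrite -raddfB; apply/P_phi/quot_pi_eq; exact: quot_pi_repr.
Qed.

Fact quot_phi_semilinear : linear_for (frob \; *:%R) quot_phi.
Proof.
move=> a x y; have [x' ->] := quot_pi_surj x; have [y' ->] := quot_pi_surj y.
by rewrite -linearP !quot_phi_pi linearP /= linearP.
Qed.

HB.instance Definition _ :=
  GRing.isLinear.Build S (quotmod P) (quotmod P) _ quot_phi quot_phi_semilinear.

Fact quot_phi_height x : linearization_image quot_phi (E ^+ r *: x).
Proof.
have [y ->] := quot_pi_surj x; have [t tE] := phi_height y.
exists [seq (sm.1, quot_pi P sm.2) | sm <- t].
rewrite -linearZ tE linear_sum big_map; apply: eq_bigr => sm _ /=.
by rewrite quot_phi_pi linearZ.
Qed.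

Definition quot_phimod : phimod :=
  @PhiMod S frob E r (quotmod P) quot_phi quot_phi_height.

Definition quot_proj : phihom X quot_phimod.
Proof.
by exists (quot_pi P) => [|x]; [apply: linearP | rewrite /= quot_phi_pi].
Defined.

End QuotientPhi.

Section SubPhi.
Variables (X : phimod) (P : submod X).
Hypothesis P_phi : forall x, P x -> P (phi X x).
Hypothesis P_height : forall x, P x -> exists2 t : seq (S * X),
  (forall sm, sm \in t -> P sm.2) & E ^+ r *: x = \sum_(sm <- t) sm.1 *: phi X sm.2.

Definition sub_phi (x : submod_type P) : submod_type P :=
  mk_sub (P_phi (submod_val_in x)).

Fact sub_phi_semilinear : linear_for (frob \; *:%R) sub_phi.
Proof. by move=> a x y; apply: val_inj; rewrite /= linearP. Qed.

HB.instance Definition _ := GRing.isLinear.Build S (submod_type P)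
  (submod_type P) _ sub_phi sub_phi_semilinear.

Fact sub_phi_height x : linearization_image sub_phi (E ^+ r *: x).
Proof.
have [t Pt tE] := P_height (submod_val_in x).
exists [seq (sm.1, insubd (0 : submod_type P) sm.2) | sm <- t].
apply: val_inj; rewrite [LHS]tE big_map [RHS](raddf_sum (val : submod_type P -> X)).
apply: eq_big_seq => sm /Pt Psm /=; rewrite insubdK //.
exact/submod_memP.
Qed.

Definition sub_phimod : phimod :=
  @PhiMod S frob E r (submod_type P) sub_phi sub_phi_height.

Definition sub_incl : phihom sub_phimod X.
Proof. by exists (@submod_val _ _ P). Defined.

End SubPhi.

End FrobeniusModules.

(** * Modules killed by a power of p *)

(* Abstracts S = W[[u]] with its reduction rd modulo p onto R = k[[u]]. *)
Record frobenius_ring (p : nat) (S R : comNzRingType) (rd : {rmorphism S -> R})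
    (frob : {rmorphism S -> S}) (u E : S) (e : nat) : Prop := FrobeniusRing {
  fr_ker : forall s, rd s = 0 <-> divides p%:R s;
  fr_order : forall s, rd s <> 0 -> exists o t t',
    rd s = rd (u ^+ o * t) /\ rd (t * t') = 1;
  fr_ureg : forall x, rd u * x = 0 -> x = 0;
  fr_udiv : forall n s, divides (p%:R ^+ n) (u * s) -> divides (p%:R ^+ n) s;
  fr_frobu : frob u = u ^+ p;
  fr_decomp : forall s, exists c : 'I_p -> S,
    rd s = rd (\sum_(i < p) u ^+ i * frob (c i));
  fr_inj : forall c : 'I_p -> S, rd (\sum_(i < p) u ^+ i * frob (c i)) = 0 ->
    forall i, rd (c i) = 0;
  fr_E : rd E = rd u ^+ e
}.

Section TorsionModules.
Variables (p : nat) (S R : comNzRingType) (rd : {rmorphism S -> R}).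
Variables (frob : {rmorphism S -> S}) (u E : S) (e : nat).
Hypothesis frS : frobenius_ring p rd frob u E e.

Local Notation pS := (p%:R : S).

Lemma fr_congr s t : rd s = rd t -> exists c, s = t + pS * c.
Proof.
move=> st; have /(fr_ker frS)[c stc] : rd (s - t) = 0 by rewrite rmorphB st subrr.
by exists c; rewrite -stc addrC subrK.
Qed.

(** In [k[[u]]] a nonzero element is a power of u times a unit; [t'] lifts the inverse of that unit,
    so both identities hold only modulo p. *)
Lemma fr_split s : ~ divides pS s -> exists o t t',
  (exists c, s = u ^+ o * t + pS * c) /\ (exists c, t * t' = 1 + pS * c).
Proof.
move=> /(fr_ker frS)/(fr_order frS)[o [t [t' [st tt']]]].
by exists o, t, t'; split; apply: fr_congr; rewrite ?rmorph1.
Qed.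

Definition ptors (M : lmodType S) n := forall x : M, pS ^+ n *: x = 0.
Definition pmod (M : lmodType S) n : submod M := multmod M (pS ^+ n).
(** Once $p^n$ kills M, the condition at n says that M itself has no u-torsion. *)
Definition usat (M : lmodType S) :=
  forall n (x : M), pmod M n (u *: x) -> pmod M n x.
Definition fgen (M : lmodType S) := exists es : seq M, forall x, seqspan es x.

Definition FItype (M : lmodType S) := [/\ fgen M, exists n, ptors M n & usat M].

Definition spanmod (M : lmodType S) d (b : 'I_d -> M) : submod M.
Proof.
exists (fun x => exists s, x = \sum_i s i *: b i) => [|a x y [s ->] [t ->]].
  by exists (fun=> 0); rewrite big1 // => i _; rewrite scale0r.
exists (fun i => a * s i + t i); rewrite scaler_sumr -big_split /=.
by apply: eq_bigr => i _; rewrite scalerDl scalerA.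
Defined.

(** The relations between the [b i] are exactly those of the standard generators of $\bigoplus_i
    S/p^{a_i}$. *)
Definition fi_basis (M : lmodType S) d (b : 'I_d -> M) (a : 'I_d -> nat) :=
  (forall x, spanmod b x) /\
  forall s, \sum_i s i *: b i = 0 <-> forall i, divides (pS ^+ a i) (s i).

Section OneModule.
Variable M : lmodType S.

Lemma spanmod_mem d (b : 'I_d -> M) i : spanmod b (b i).
Proof.
exists (fun j => (j == i)%:R); rewrite (bigD1 i) //= eqxx scale1r big1 ?addr0 //.
by move=> j /negPf->; rewrite scale0r.
Qed.

Lemma spanmod_min d (b : 'I_d -> M) (P : submod M) :
  (forall i, P (b i)) -> forall x, spanmod b x -> P x.
Proof. by move=> Pb x [s ->]; apply: submod_sum => i; apply: submodZ. Qed.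

Lemma ptors_le m n : (m <= n)%N -> ptors M m -> ptors M n.
Proof. by move=> le_mn Mm x; rewrite -(subnK le_mn) exprD -scalerA Mm scaler0. Qed.

Lemma usat_exp n o x : usat M -> pmod M n (u ^+ o *: x) -> pmod M n x.
Proof. by move=> usM; elim: o => [|o IHo]; rewrite ?scale1r // exprS -scalerA => /usM. Qed.

(** As p is nilpotent on M, substituting $M = P + pM$ into itself gives $M = P + p^m M$ for every
    m. *)
Lemma nakayama n (P : submod M) : ptors M n ->
  (forall x, addmod P (pmod M 1) x) -> forall x, P x.
Proof.
move=> Mn PM; suff PMm m x : addmod P (pmod M m) x.
  by move=> x; have [y Py [z /eqP]] := PMm n x; rewrite Mn subr_eq0 => /eqP->.
elim: m x => [|m IHm] x; first by apply: addmodr; exists x; rewrite scale1r.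
have [y Py [z xE]] := IHm x; have [y' Py' [z' zE]] := PM z.
exists (y + pS ^+ m *: y'); first by apply: submodD => //; apply: submodZ.
exists z'; rewrite opprD addrA xE -scalerBr zE scalerA expr1 -exprSr //.
Qed.

(** Here v is the p-adic valuation of s capped at a; the cap also covers s = 0, and coefficients
    matter only modulo $p^a$. *)
Lemma pval_split a s : exists v s',
  [/\ (v <= a)%N, s = pS ^+ v * s' & v = a \/ ~ divides pS s'].
Proof.
elim: a => [|a [v [s' [le_va sE v_max]]]].
  by exists 0%N, s; split; rewrite ?mul1r //; left.
case: v_max => [va|nd]; last by exists v, s'; split; [apply: leqW| |right].
have [[t s'E]|nd] := pselect (divides pS s'); last first.
  by exists v, s'; split; [apply: leqW| |right].
by exists a.+1, t; split; [|rewrite sE va s'E mulrA exprSr|left].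
Qed.

(* A relation that is not forced by the exponents produces, after division by
   the largest possible powers of p and of u, a combination of the generators
   that has smaller exponent and can replace one of them. *)
Lemma fi_improve d n (b : 'I_d -> M) (a : 'I_d -> nat) :
  usat M -> ptors M n -> (forall x, spanmod b x) ->
  (forall i, pS ^+ a i *: b i = 0) ->
  ~ (forall s, \sum_i s i *: b i = 0 -> forall i, divides (pS ^+ a i) (s i)) ->
  exists j b' a', [/\ (a' < a j)%N, forall x, spanmod b' x,
    pS ^+ a' *: b' j = 0 & forall i, i != j -> b' i = b i].
Proof.
move=> usM Mn span_b ab /existsNP[s /not_implyP[s0 /existsNP[j nd_j]]].
have /choice[w wP] i : exists w : nat * S, [/\ (w.1 <= a i)%N,
    s i = pS ^+ w.1 * w.2 & w.1 = a i \/ ~ divides pS w.2].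
  by have [v [s' ?]] := pval_split (a i) (s i); exists (v, s').
(* [J] selects the terms that can be nonzero, the others being killed by [ab]; the least exponent m
   over [J] is then divided out, leaving the coefficients [c i]. *)
pose v i := (w i).1; pose J i := (v i < a i)%N.
have Jj : J j.
  have [le_v sE _] := wP j; rewrite /J ltn_neqAle le_v andbT.
  by apply/eqP => va; case: nd_j; exists (w j).2; rewrite sE -/(v j) va.
case: (@arg_minnP _ j J v Jj) => j0 Jj0 min_v; pose m := v j0.
pose c i := if J i then pS ^+ (v i - m) * (w i).2 else 0.
have cP i : s i *: b i = pS ^+ m *: (c i *: b i).
  have [le_v sE _] := wP i; rewrite /c; case: ifPn => [Ji|].
    by rewrite sE scalerA mulrA -exprD subnKC ?min_v.
  rewrite -leqNgt => ge_v; rewrite scale0r scaler0 sE mulrC -scalerA.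
  by rewrite (_ : (w i).1 = a i) ?ab ?scaler0 //; apply/eqP; rewrite eqn_leq le_v.
have nd_c0 : ~ divides pS (c j0).
  rewrite /c Jj0 subnn mul1r; have [_ _ [va|//]] := wP j0.
  by move: Jj0; rewrite /J /v va ltnn.
have nd_c i : ~ divides pS (c i) -> (m < a i)%N.
  rewrite /c; case: ifP => [Ji nd|_ []]; last by exists 0; rewrite mulr0.
  have [lt_mv|le_vm] := ltnP m (v i).
    by case: nd; exists (pS ^+ (v i - m).-1 * (w i).2); rewrite mulrA -exprS prednK ?subn_gt0.
  exact: leq_ltn_trans (min_v i Ji) Ji.
have /choice[q qP] i : exists q : nat * S * S, ~ divides pS (c i) ->
    (exists d, c i = u ^+ q.1.1 * q.1.2 + pS * d) /\
    (exists d, q.1.2 * q.2 = 1 + pS * d).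
  have [dc|/fr_split[o [t [t' ?]]]] := pselect (divides pS (c i)).
    by exists (0%N, 0, 0).
  by exists (o, t, t').
pose Q i := `[< ~ divides pS (c i) >]; pose o i := (q i).1.1.
have Qj0 : Q j0 by apply/asboolP.
(* Among the [c i] nonzero modulo p, [j1] has the least u-order; after division by that power of u
   its coefficient [T j1] is a unit modulo p. *)
case: (@arg_minnP _ j0 Q o Qj0) => j1 /asboolP Qj1 min_o.
pose T i := if Q i then u ^+ (o i - o j1) * (q i).1.2 else 0.
have /choice[D DP] i : exists D, c i = u ^+ o j1 * T i + pS * D.
  rewrite /T /Q; case: (asboolP (~ divides pS (c i))) => [Qi|/contrapT[D ->]]; last first.
    by exists D; rewrite mulr0 add0r.
  have [[D cE] _] := qP i Qi; exists D; rewrite cE mulrA -exprD subnKC //.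
  exact/min_o/asboolP.
pose y := \sum_i T i *: b i; pose y1 := \sum_i D i *: b i.
(* With o = [o j1] the relation reads $p^m(u^o y + p y_1) = 0$, so $u^o p^m y \in p^{m+1}M$, and
   [usat] removes the power of u. *)
have : pmod M m.+1 (pS ^+ m *: y).
  apply: (@usat_exp _ (o j1) _ usM); exists (- y1); apply/eqP.
  rewrite scalerN -addr_eq0 -[X in _ == X]s0; apply/eqP.
  rewrite (eq_bigr _ (fun i _ => cP i)) -scaler_sumr exprSr -[X in _ + X]scalerA.
  rewrite scalerA [_ * pS ^+ m]mulrC -scalerA -scalerDr; congr (_ *: _).
  rewrite !scaler_sumr -big_split; apply: eq_bigr => i _ /=.
  by rewrite DP scalerDl !scalerA.
(* As $p^m y = p^{m+1} z$, the new generator $y - pz$ is killed by $p^m$, and [m < a j1]. *)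
case=> z zE; pose b' i := if i == j1 then y - pS *: z else b i.
exists j1, b', m; split; first exact: nd_c.
(* Since [T j1] is a unit modulo p, [b j1] can be recovered modulo p from the new generators. *)
- apply: nakayama Mn _ => x.
  apply: (spanmod_min _ (span_b x)) => i {x}.
  have P_b' l : addmod (spanmod b') (pmod M 1) (b' l) by apply/addmodl/spanmod_mem.
  have [->|ne_i] := eqVneq i j1; last by have := P_b' i; rewrite /b' (negPf ne_i).
  have P_p x : addmod (spanmod b') (pmod M 1) (pS *: x).
    by apply: addmodr; exists x.
  have [_ [t' tE]] := qP j1 Qj1.
  apply: (@submod_addr _ _ _ _ (pS *: (t' *: b j1))) => //.
  have -> : b j1 + pS *: (t' *: b j1) = (q j1).2 *: (T j1 *: b j1).
    rewrite /T /Q (asboolT Qj1) subnn mul1r [RHS]scalerA [(q j1).2 * _]mulrC tE.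
    by rewrite scalerDl scale1r scalerA.
  apply: submodZ.
  have -> : T j1 *: b j1 = b' j1 + pS *: z - \sum_(i | i != j1) T i *: b i.
    by rewrite /b' eqxx subrK /y (bigD1 j1) //= addrK.
  apply: submodB; first exact: submodD.
  apply: big_ind => [|x x'|l ne_l]; [exact: submod0 | exact: submodD |].
  by have := P_b' l; rewrite /b' (negPf ne_l); apply: submodZ.
- by rewrite /b' eqxx scalerBr zE scalerA -exprSr subrr.
- by move=> i /negPf ne_i; rewrite /b' ne_i.
Qed.
End OneModule.
End TorsionModules.

(** * Decomposition into cyclic modules *)

Section FIModules.
Variables (p : nat) (S R : comNzRingType) (rd : {rmorphism S -> R}).
Variables (frob : {rmorphism S -> S}) (u E : S) (e : nat).
Hypothesis frS : frobenius_ring p rd frob u E e.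

Local Notation pS := (p%:R : S).

(** Induction on [d + \sum_i a i]: a generator of exponent 0 is dropped, and as long as there is an
    unforced relation [fi_improve] lowers an exponent. *)
Lemma fi_basis_exists (M : lmodType S) n N d (b : 'I_d -> M) (a : 'I_d -> nat) :
  usat p u M -> ptors p M n -> (forall x, spanmod b x) ->
  (forall i, pS ^+ a i *: b i = 0) -> (forall i, a i <= N)%N ->
  exists d' (b' : 'I_d' -> M) a',
    fi_basis p b' a' /\ forall i, (0 < a' i <= N)%N.
Proof.
move=> usM Mn; have [m] := ubnP (d + \sum_i a i)%N.
elim: m => // m IHm in d b a *; rewrite ltnS => le_m span_b ab aN.
have [[j aj0]|a_gt0] := pselect (exists j, a j = 0%N).
  case: d => [|d] in b a le_m span_b ab aN j aj0 *; first by case: j aj0.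
  have bj0 : b j = 0 by have := ab j; rewrite aj0 scale1r.
  apply: (IHm d (b \o lift j) (a \o lift j)) => [|x|i|i]; last 2 first.
  - exact: ab.
  - exact: aN.
  - by apply: leq_trans le_m; rewrite addSn ltnS leq_add2l (bigD1_ord j) //= leq_addl.
  - apply: spanmod_min (span_b x) => i; have [->|ne_ji] := eqVneq i j.
      by rewrite bj0; apply: submod0.
    rewrite eq_sym in ne_ji; by have [l -> _] := unlift_some ne_ji; apply: (spanmod_mem (b \o lift j)).
have [rel|nrel] := pselect (forall s, \sum_i s i *: b i = 0 ->
    forall i, divides (pS ^+ a i) (s i)).
  exists d, b, a; split=> [|i]; last first.
    by rewrite aN andbT lt0n; apply/eqP => ai0; case: a_gt0; exists i.
  split=> // s; split=> [/rel//|ds]; apply: big1 => i _.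
  by have [c ->] := ds i; rewrite mulrC -scalerA ab scaler0.
have [j [b' [a' [lt_a' span_b' ab'j b'E]]]] := fi_improve frS usM Mn span_b ab nrel.
apply: (IHm d b' (fun i => if i == j then a' else a i)) => // [|i|i].
- apply: leq_trans le_m; rewrite ltn_add2l (bigD1 j) //= eqxx [X in (_ < X)%N](bigD1 j) //=.
  rewrite -addSn leq_add //; apply: leq_sum => i /negPf-> //.
- by case: eqVneq => [->//|/b'E->].
- by case: eqVneq => // _; apply: leq_trans (ltnW lt_a') (aN j).
Qed.

(** The starting point is any finite generating set, each generator being given the exponent N. *)
Lemma FItype_basis (M : lmodType S) N : FItype p u M -> ptors p M N ->
  exists d (b : 'I_d -> M) a, fi_basis p b a /\ forall i, (0 < a i <= N)%N.
Proof.
case=> [[es span_es] _ usM] MN.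
apply: (@fi_basis_exists M N N (size es) (fun i => nth 0 es i) (fun=> N)) => //.
by move=> x; apply: seqspan_coef.
Qed.

Lemma divides_exp_le (m n : nat) (s : S) :
  (m <= n)%N -> divides (pS ^+ n) s -> divides (pS ^+ m) s.
Proof. by move=> le_mn [c ->]; exists (pS ^+ (n - m) * c); rewrite mulrA -exprD subnKC. Qed.

Lemma dividesD (c x y : S) : divides c x -> divides c y -> divides c (x + y).
Proof. by move=> [a ->] [b ->]; exists (a + b); rewrite mulrDr. Qed.

Lemma spanmod_fgen (M : lmodType S) d (b : 'I_d -> M) :
  (forall x, spanmod b x) -> fgen M.
Proof.
move=> span_b; exists [seq b i | i <- enum 'I_d] => x.
apply: spanmod_min (span_b x) => i; apply: seqspan_mem.
by apply: map_f; rewrite mem_enum.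
Qed.

Lemma fi_basis_tors (M : lmodType S) d (b : 'I_d -> M) a i :
  fi_basis p b a -> pS ^+ a i *: b i = 0.
Proof.
case=> _ rel; transitivity (\sum_j (if j == i then pS ^+ a i else 0) *: b j).
  rewrite (bigD1 i) //= eqxx big1 ?addr0 // => j /negPf->; exact: scale0r.
apply/rel => j; case: eqVneq => [->|_]; first by exists 1; rewrite mulr1.
by exists 0; rewrite mulr0.
Qed.

Lemma fi_basis_FItype (M : lmodType S) d (b : 'I_d -> M) a :
  fi_basis p b a -> FItype p u M.
Proof.
move=> ba; have [span_b rel] := ba; split; first exact: spanmod_fgen span_b.
  exists (\sum_i a i)%N => x; move: x (span_b x).
  apply: (@spanmod_min _ _ _ _ (colonmod zeromod (pS ^+ (\sum_i a i)))) => i /=.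
  by rewrite (bigD1 i) //= addnC exprD -scalerA fi_basis_tors ?scaler0.
move=> n x; have [s ->] := span_b x; case=> y; have [t ->] := span_b y => /eqP.
rewrite -subr_eq0 !scaler_sumr -sumrB.
under eq_bigr do rewrite !scalerA -scalerBl.
move=> /eqP/rel dst.
(* $u s_i - p^n t_i$ is divisible by $p^{a_i}$, hence $s_i$ by $p^{\min(n, a_i)}$; if the minimum is
   $a_i$, the term $s_i b_i$ is zero and c = 0 serves. *)
have /choice[c cP] i : exists c, s i *: b i = pS ^+ n *: (c *: b i).
  have : divides (pS ^+ minn n (a i)) (s i).
    apply: (fr_udiv frS); rewrite -(subrK (pS ^+ n * t i) (u * s i)).
    apply: dividesD; first exact: divides_exp_le (geq_minr _ _) (dst i).
    by apply: divides_exp_le (geq_minl _ _) _; exists (t i).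
  rewrite /minn; case: ltnP => _ [c sE]; first by exists c; rewrite sE scalerA.
  exists 0; by rewrite scale0r scaler0 sE mulrC -scalerA fi_basis_tors ?scaler0.
exists (\sum_i c i *: b i); rewrite scaler_sumr; exact: eq_bigr.
Qed.

(** Two coordinate vectors give the same element for [b] exactly when they do for [b'], so matching
    arbitrarily chosen coordinates is well defined. *)
Lemma fi_basis_iso (M M' : lmodType S) d (b : 'I_d -> M) (b' : 'I_d -> M') a :
  fi_basis p b a -> fi_basis p b' a -> lmod_iso M M'.
Proof.
move=> [span_b rel] [span_b' rel'].
have eqbb' s t : \sum_i s i *: b i = \sum_i t i *: b i <->
    \sum_i s i *: b' i = \sum_i t i *: b' i.
  have sumB (N : lmodType S) (c : 'I_d -> N) : \sum_i s i *: c i = \sum_i t i *: c i <->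
      \sum_i (s i - t i) *: c i = 0.
    under [in X in _ <-> X]eq_bigr do rewrite scalerBl.
    by rewrite sumrB; split=> [->|/eqP]; rewrite ?subrr // subr_eq0 => /eqP.
  by rewrite !sumB rel rel'.
have /choice[s sP] x : exists s, x = \sum_i s i *: b i by apply: span_b.
have /choice[t tP] x : exists s, x = \sum_i s i *: b' i by apply: span_b'.
pose f x := \sum_i s x i *: b' i.
have f_lin : linear f.
  move=> c x y; rewrite /f scaler_sumr -big_split /=.
  under [in RHS]eq_bigr do rewrite scalerA -scalerDl.
  apply/eqbb'; rewrite -sP; under eq_bigr do rewrite scalerDl -scalerA.
  by rewrite big_split /= -scaler_sumr -!sP.
pose F : {linear M -> M'} := HB.pack f (GRing.isLinear.Build S M M' *:%R f f_lin).
exists F; exists (fun y => \sum_i t y i *: b i) => [x|y].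
  by rewrite [RHS]sP; apply/eqbb'; rewrite -tP.
by rewrite [RHS]tP; apply/eqbb'; rewrite -sP.
Qed.

Lemma direct_sum_basis d (a : 'I_d -> nat) :
  exists b : 'I_d -> direct_sum [seq quot_pow S p i | i <- [seq a i | i <- enum 'I_d]],
    fi_basis p b a.
Proof.
elim: d a => [|d IHd] a.
  exists (fun=> 0); split=> [x|s]; last by split=> [_ []//|_]; rewrite big_ord0.
  have -> : x = 0; last exact: submod0.
  move: x; rewrite (size0nil (size_enum_ord 0)) => x.
  exact: thinmx0.
rewrite enum_ordSl /= -(map_comp a).
have [b [span_b rel]] := IHd (a \o lift ord0).
pose M0 := quot_pow S p (a ord0).
pose b' i := if unlift ord0 i is Some j then (0, b j)
             else (cyclic_pi (pS ^+ a ord0) 1 : M0, 0).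
have b'E s : \sum_i s i *: b' i =
    (cyclic_pi _ (s ord0) : M0, \sum_i s (lift ord0 i) *: b i).
  rewrite big_ord_recl /b' unlift_none.
  under eq_bigr do rewrite liftK.
  rewrite (eq_bigr (fun i => (0, s (lift ord0 i) *: b i))) => [|i _]; last first.
    by congr pair; apply: scaler0.
  have -> : \sum_i ((0, s (lift ord0 i) *: b i) : M0 * _) =
      (0, \sum_i s (lift ord0 i) *: b i).
    by elim/big_rec2: _ => // i x _ _ ->; congr pair; rewrite addr0.
  congr pair; last by rewrite [X in X + _]scaler0 add0r.
  by rewrite [LHS]addr0 [LHS]cyclic_scale_pi mulr1.
exists b'; split=> [[x y]|s].
  have [x' ->] := cyclic_piP x; have [s ->] := span_b y.
  exists (fun i => oapp s x' (unlift ord0 i)); rewrite b'E unlift_none /=.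
  by congr pair; apply: eq_bigr => i _; rewrite liftK.
have pi0 : cyclic_pi (pS ^+ a ord0) 0 = 0.
  by apply: (addrI (cyclic_pi _ 0)); rewrite -cyclic_piD !addr0.
rewrite b'E; split=> [[s0 s1] i|ds].
  case: (unliftP ord0 i) => [j|] ->; first by have /rel := s1; apply.
  have /cyclic_pi_eq[c] : cyclic_pi (pS ^+ a ord0) (s ord0) = cyclic_pi _ 0.
    by rewrite pi0.
  by rewrite subr0 => sE; exists c.
congr pair; last by apply/rel => i; apply: ds.
by rewrite -[RHS]pi0; apply/cyclic_pi_eq; have [c ->] := ds ord0; exists c; rewrite subr0.
Qed.

Lemma fi_basis_lmod_iso (M N : lmodType S) d (b : 'I_d -> N) a :
  lmod_iso M N -> fi_basis p b a -> exists b' : 'I_d -> M, fi_basis p b' a.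
Proof.
move=> [f [g fK gK]] [span_b rel]; exists (g \o b).
have fE s : f (\sum_i s i *: (g \o b) i) = \sum_i s i *: b i.
  by rewrite linear_sum; apply: eq_bigr => i _; rewrite linearZ /= gK.
split=> [x|s].
  by have [s fxE] := span_b (f x); exists s; apply: (can_inj fK); rewrite fE.
rewrite -rel -fE; split=> [->|f0]; first exact: linear0.
by apply: (can_inj fK); rewrite f0 linear0.
Qed.

Lemma FItypeP (M : lmodType S) : FItype p u M <->
  exists a : seq nat, lmod_iso M (direct_sum [seq quot_pow S p i | i <- a]).
Proof.
split=> [M_FI|[a]].
  have [_ [n Mn] _] := M_FI; have [d [b [a [ba _]]]] := FItype_basis M_FI Mn.
  have [b' b'a] := direct_sum_basis a.
  by exists [seq a i | i <- enum 'I_d]; apply: fi_basis_iso ba b'a.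
have -> : a = [seq nth 0%N a (i : 'I_(size a)) | i <- enum 'I_(size a)].
  apply: (@eq_from_nth _ 0%N) => [|i lt_i]; first by rewrite size_map size_enum_ord.
  by rewrite (nth_map (Ordinal lt_i)) ?size_enum_ord ?nth_enum_ord.
move=> iso; have [b ba] := direct_sum_basis (fun i : 'I_(size a) => nth 0%N a i).
by have [b' /fi_basis_FItype] := fi_basis_lmod_iso iso ba.
Qed.

Lemma FItype_ptors1 (M : lmodType S) : FItype p u M -> ptors p M 1 ->
  exists n, lmod_iso M (direct_sum (nseq n (quot_pow S p 1))).
Proof.
move=> M_FI /(FItype_basis M_FI)[d [b [a [ba a1]]]].
have [b' b'a] := direct_sum_basis a; exists d.
have -> : nseq d (quot_pow S p 1) = [seq quot_pow S p i | i <- [seq a i | i <- enum 'I_d]].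
  rewrite -map_comp (eq_map (_ : _ =1 fun=> quot_pow S p 1)) => [|i /=].
    by rewrite -{1}(size_enum_ord d); elim: (enum _) => //= i l ->.
  by rewrite (_ : a i = 1%N) //; apply/eqP; rewrite eqn_leq andbC.
exact: fi_basis_iso ba b'a.
Qed.

End FIModules.

(** * Noetherianity and bounded u-torsion *)

Section Noetherian.
Variables (p : nat) (S R : comNzRingType) (rd : {rmorphism S -> R}).
Variables (frob : {rmorphism S -> S}) (u E : S) (e : nat).
Hypothesis frS : frobenius_ring p rd frob u E e.
Variable M : lmodType S.

Local Notation pS := (p%:R : S).

Definition noeth (V : submod M) := forall P : submod M, (forall x, P x -> V x) ->
  exists2 es : seq M, forall x, x \in es -> P x & forall x, P x -> seqspan es x.

Lemma noeth_sub (V V' : submod M) :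
  (forall x, V' x -> V x) -> noeth V -> noeth V'.
Proof. by move=> V'V nV P PV'; apply: nV => x /PV'/V'V. Qed.

(** The s with $sy + v \in P$ for some v in V form an ideal [J] containing p. If its image modulo p
    is nonzero, the least power $u^o$ in [J] generates that image, and P is generated by one element
    $u^o y + v_0$ together with generators of $P \cap V$. *)
Lemma noeth_step (V : submod M) y :
  noeth V -> V (pS *: y) -> noeth (addmod (linemod y) V).
Proof.
move=> nV Vpy P PV.
pose J s := exists2 v, V v & P (s *: y + v).
have JZ a s : J s -> J (a * s).
  by move=> [v Vv Pv]; exists (a *: v); rewrite -?scalerA -?scalerDr; apply: submodZ.
have Jp c s : J (s + pS * c) -> J s.
  move=> [v Vv Pv]; exists (pS *: (c *: y) + v).
    by apply: submodD => //; rewrite scalerA mulrC -scalerA; apply: submodZ.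
  by rewrite addrA scalerA -scalerDl.
have Jx x : P x -> exists2 s, J s & V (x - s *: y).
  move=> Px; have [_ [s ->] Vx] := PV x Px; exists s => //.
  by exists (x - s *: y) => //; rewrite addrC subrK.
have Ju s : J s -> ~ divides pS s ->
    exists2 o, J (u ^+ o) & exists t c, s = u ^+ o * t + pS * c.
  move=> Js /(fr_split frS)[o [t [t' [[c sE] [c' tE]]]]]; exists o; last by exists t, c.
  apply: (@Jp (c' * u ^+ o)).
  suff -> : u ^+ o + pS * (c' * u ^+ o) = t' * (u ^+ o * t).
    by apply: JZ; apply: (@Jp c); rewrite -sE.
  by rewrite [RHS]mulrCA [t' * t]mulrC tE mulrDr mulr1 [X in _ = _ + X]mulrC mulrA.
(* If every element of [J] is a multiple of p, then P lies in V because $py \in V$. *)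
have [[s [Js nd]]|J_p] := pselect (exists s, J s /\ ~ divides pS s); last first.
  apply: nV => x Px; have [s Js Vx] := Jx x Px.
  rewrite -(subrK (s *: y) x); apply: submodD => //.
  have [[c ->]|nd] := pselect (divides pS s).
    by rewrite mulrC -scalerA; apply: submodZ.
  by case: J_p; exists s.
have exJ : exists o, `[< J (u ^+ o) >].
  by have [o Jo _] := Ju s Js nd; exists o; apply/asboolP.
case: (ex_minnP exJ) => o /asboolP[v0 Vv0 Pv0] min_o.
have [es Pes span_es] := nV (capmod P V) (fun x => @proj2 _ _).
exists (u ^+ o *: y + v0 :: es) => [x|x Px].
  by rewrite inE => /predU1P[->//|/Pes[]].
have [t Jt Vx] := Jx x Px.
have [t' [c tE]] : exists t' c, t = u ^+ o * t' + pS * c.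
  have [[c ->]|nd'] := pselect (divides pS t).
    by exists 0, c; rewrite mulr0 add0r.
  have [o' Jo' [t' [c tE]]] := Ju t Jt nd'.
  exists (u ^+ (o' - o) * t'), c; rewrite mulrA -exprD subnKC //.
  exact/min_o/asboolP.
exists (t' *: (u ^+ o *: y + v0)); first by exists t'.
apply: span_es; split; first by apply: submodB => //; apply: submodZ.
have -> : x - t' *: (u ^+ o *: y + v0) = x - t *: y + (c *: (pS *: y) - t' *: v0).
  rewrite tE scalerDr scalerDl !scalerA [t' * _]mulrC [c * _]mulrC !opprD.
  by rewrite -!addrA [- (pS * c *: y) + _]addrA addNr add0r.
apply: submodD Vx _; apply: submodB; exact: submodZ.
Qed.

(** Climbs from $p^n M = 0$ up to M: $p^{n-m-1}M$ arises from $p^{n-m}M$ by adjoining $p^{n-m-1}y$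
    for the finitely many generators y, one at a time. *)
Lemma noeth_ptors n : fgen M -> ptors p M n -> noeth topmod.
Proof.
move=> [es span_es] Mn.
suff nP m : noeth (pmod p M (n - m)).
  by apply: noeth_sub (nP n) => x _; exists x; rewrite subnn scale1r.
elim: m => [|m IHm].
  move=> P P0; exists [::] => // x /P0[y ->]; rewrite subn0; exact: Mn.
(* Subtraction is truncated: for $n \le m$ both differences are 0 and both submodules are M. *)
have [le_nm|lt_mn] := leqP n m.
  by apply: noeth_sub IHm => x; rewrite (eqP le_nm) (eqP (leqW le_nm)).
pose V := foldr (fun y V => addmod (linemod (pS ^+ (n - m.+1) *: y)) V) (pmod p M (n - m)).
have VP ys : (forall x, pmod p M (n - m) x -> V ys x) /\ noeth (V ys).
  elim: ys => [|y ys [sV nV]] //; split=> [x /sV|]; first exact: addmodr.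
  apply: noeth_step => //; apply: sV; exists y.
  by rewrite scalerA -exprS subnSK.
have [_ nV] := VP es; apply: noeth_sub nV => _ [x ->].
have : colonmod (V es) (pS ^+ (n - m.+1)) x; last by [].
apply: seqspan_min (span_es x) => y /= {span_es}.
elim: es {VP} => // z es IHes; rewrite inE => /predU1P[->|/IHes]; last exact: addmodr.
exact/addmodl/linemod_id.
Qed.

(** The u-power saturation of P is finitely generated, so a single exponent serves all its
    generators. *)
Lemma torsion_bounded n (P : submod M) : fgen M -> ptors p M n ->
  exists N, forall x m, P (u ^+ m *: x) -> P (u ^+ N *: x).
Proof.
move=> Mfg /(noeth_ptors Mfg)/(_ (satmod P u) (fun _ _ => I))[es sat_es span_es].
suff [N NP] : exists N, forall x, x \in es -> P (u ^+ N *: x).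
  exists N => x m Px; have : colonmod P (u ^+ N) x; last by [].
  by apply: seqspan_min (span_es x _) => //; exists m.
elim: es sat_es {span_es} => [|y es IHes] sat_es; first by exists 0%N.
have [m Pm] := sat_es y (mem_head _ _).
have [x|N NP] := IHes; first by move=> es_x; apply: sat_es; rewrite inE es_x orbT.
exists (m + N)%N => x; rewrite inE => /predU1P[->|/NP].
  by rewrite addnC exprD -scalerA; apply: submodZ.
by rewrite exprD -scalerA; apply: submodZ.
Qed.

End Noetherian.

(** * The linearization of phi *)

Section FrobeniusCombinations.
Variables (p : nat) (S R : comNzRingType) (rd : {rmorphism S -> R}).
Variables (frob : {rmorphism S -> S}) (u E : S) (e r : nat).
Hypothesis frS : frobenius_ring p rd frob u E e.

Local Notation pS := (p%:R : S).
Local Notation phimod := (phimod frob E r).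

(** Successive approximation: the decomposition modulo p is applied to the remainder, and [frob]
    fixes p. *)
Lemma fr_decomp_exp n s : exists (c : 'I_p -> S) d,
  s = \sum_(i < p) u ^+ i * frob (c i) + pS ^+ n * d.
Proof.
elim: n => [|n [c [d ->]]].
  exists (fun=> 0), s; rewrite mul1r big1 ?add0r // => i _.
  by rewrite rmorph0 mulr0.
have [c' /(fr_congr frS)[d' ->]] := fr_decomp frS d.
exists (fun i => c i + pS ^+ n * c' i), d'.
rewrite mulrDr addrA mulr_sumr -big_split mulrA -exprSr; congr (_ + _).
apply: eq_bigr => i _ /=.
by rewrite rmorphD rmorphM rmorphXn rmorph_nat mulrDr mulrCA.
Qed.

(** The linearization of [phi] at the sum of the tensors of [u ^+ i] with [z i]. *)
Definition frobcomb (X : phimod) (z : 'I_p -> X) : X := \sum_(i < p) u ^+ i *: phi X (z i).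

Lemma frobcombD (X : phimod) (z z' : 'I_p -> X) :
  frobcomb (fun i => z i + z' i) = frobcomb z + frobcomb z'.
Proof. by rewrite -big_split; apply: eq_bigr => i _; rewrite raddfD scalerDr. Qed.

Lemma frobcombB (X : phimod) (z z' : 'I_p -> X) :
  frobcomb (fun i => z i - z' i) = frobcomb z - frobcomb z'.
Proof. by rewrite -sumrB; apply: eq_bigr => i _; rewrite raddfB scalerBr. Qed.

Lemma frobcombZp (X : phimod) n (z : 'I_p -> X) :
  frobcomb (fun i => pS ^+ n *: z i) = pS ^+ n *: frobcomb z.
Proof.
rewrite /frobcomb scaler_sumr; apply: eq_bigr => i _.
by rewrite linearZ /= rmorphXn rmorph_nat !scalerA mulrC.
Qed.

Lemma frobcomb_hom (X Y : phimod) (f : phihom X Y) (z : 'I_p -> X) :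
  f (frobcomb z) = frobcomb (fun i => f (z i)).
Proof. by rewrite linear_sum; apply: eq_bigr => i _; rewrite linearZ /= phihom_comm. Qed.

Lemma frobcomb_single (X : phimod) (i : 'I_p) (x : X) :
  u ^+ i *: phi X x = frobcomb (fun j => if j == i then x else 0).
Proof.
rewrite /frobcomb (bigD1 i) //= eqxx big1 ?addr0 // => j /negPf->.
by rewrite raddf0 scaler0.
Qed.

Lemma linearization_frobcomb (X : phimod) n (x : X) : ptors p X n ->
  linearization_image (phi X) x -> exists z, x = frobcomb z.
Proof.
move=> Xn [t ->]; elim: t => [|[s y] t [z IHt]].
  exists (fun=> 0); rewrite big_nil /frobcomb big1 // => i _.
  by rewrite raddf0 scaler0.
have [c [d sE]] := fr_decomp_exp n s.
exists (fun i => c i *: y + z i); rewrite big_cons frobcombD IHt; congr (_ + _).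
rewrite /= sE scalerDl -[X in _ + X]scalerA Xn addr0 scaler_suml.
by apply: eq_bigr => i _; rewrite linearZ /= scalerA.
Qed.

Lemma frobcomb_height (X : phimod) n (x : X) : ptors p X n ->
  exists z, E ^+ r *: x = frobcomb z.
Proof. by move=> Xn; apply: linearization_frobcomb Xn (phi_height x). Qed.

Lemma fr_Er : exists c, E ^+ r = u ^+ (e * r) + pS * c.
Proof. by apply: (fr_congr frS); rewrite !rmorphXn (fr_E frS) exprM. Qed.

Lemma frob_exp q : frob (u ^+ q) = u ^+ (p * q).
Proof. by rewrite rmorphXn (fr_frobu frS) exprM. Qed.

(* If u^n kills the u-torsion of A/D, then u^(n+er) phi(y) lies in the span of
   phi(D) for every torsion y; writing n + er = pq + t and comparing the
   components at u^t shows that already u^q kills it, and q < n as long as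
   n > 0 because er < p - 1. *)
Lemma torsion_free_quotient (X : phimod) n (A B D : submod X) :
  (e * r < p - 1)%N -> fgen X -> ptors p X n ->
  (forall x, A x -> A (phi X x)) -> (forall x, D x -> D (phi X x)) ->
  (forall x, A x -> B (pS *: x)) -> (forall x, B x -> D x) ->
  (forall x, D x -> A x) ->
  (forall z, (forall i, A (z i)) -> B (frobcomb z) -> forall i, B (z i)) ->
  (forall x, D x -> exists2 z, forall i, D (z i) & B (E ^+ r *: x - frobcomb z)) ->
  forall x, A x -> D (u *: x) -> D x.
Proof.
move=> er_lt Xfg Xn Aphi Dphi pAB BD DA injAB heightD.
(* The subquotient $A/B$ is killed by p, and $D/B$ is the submodule to be shown saturated; N bounds
   the u-torsion modulo D. *)
have [N NP] := torsion_bounded frS D Xfg Xn.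
have p_gt0 : (0 < p)%N by case: p er_lt.
(* Each step lowers by one the power of u killing all u-torsion of $A/D$; at m = N this power is
   $u^0$. *)
suff DN m : (m <= N)%N -> forall y o, A y -> D (u ^+ o *: y) -> D (u ^+ (N - m) *: y).
  by move=> x Ax Dx; rewrite -[x]scale1r -(expr0 u) -(subnn N); apply: (DN _ _ x 1%N).
elim: m => [_ y o _|m IHm lt_mN y o Ay Dy]; first by rewrite subn0; apply: NP.
set l := (N - m)%N in IHm; have l_gt0 : (0 < l)%N by rewrite subn_gt0.
have Dphi_y : D (u ^+ l *: phi X y).
  apply: (IHm (ltnW lt_mN) _ (p * o)%N); first exact: Aphi.
  by have := Dphi _ Dy; rewrite linearZ /= frob_exp.
have [z Dz] := heightD _ Dphi_y; have [c ->] := fr_Er.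
pose q := ((l + e * r) %/ p)%N; pose t := Ordinal (ltn_pmod (l + e * r) p_gt0).
have -> : (u ^+ (e * r) + pS * c) *: (u ^+ l *: phi X y) =
    u ^+ t *: phi X (u ^+ q *: y) + pS *: ((c * u ^+ l) *: phi X y).
  rewrite scalerDl [phi X (_ *: _)]linearZ /= frob_exp !scalerA mulrA; congr (_ *: _ + _).
  rewrite -!exprD; congr (u ^+ _).
  by rewrite addnC [LHS](divn_eq _ p) [LHS]addnC [(_ %/ _ * _)%N]mulnC.
rewrite frobcomb_single addrAC => Bz.
(* The multiple of p in $E^r$ contributes an element of B and is discarded. *)
have {Bz} Bz := submod_addr (pAB _ (submodZ (c * u ^+ l) (Aphi _ Ay))) Bz.
have Dq : D (u ^+ q *: y).
  rewrite -frobcombB in Bz.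
  have := injAB _ _ Bz t; rewrite eqxx => BD_t.
  rewrite -(subrK (z t) (u ^+ q *: y)); apply: submodD (Dz t); apply/BD/BD_t => i.
  apply: submodB; last exact/DA/Dz.
  by case: eqP => _; [apply: submodZ | apply: submod0].
(* From $er < p - 1 \le (p-1)l$ follows $l + er < pl$, so q is at most $l - 1$. *)
have le_q : (q <= N - m.+1)%N.
  rewrite subnS -ltnS prednK // ltn_divLR // -[X in (_ < _ * X)%N](subnK p_gt0).
  rewrite mulnDr muln1 addnC ltn_add2r (leq_trans er_lt) // leq_pmull //.
by rewrite -(subnK le_q) exprD -scalerA; apply: submodZ.
Qed.
End FrobeniusCombinations.

(** * Injectivity of the linearization *)

Section Injectivity.
Variables (p : nat) (S R : comNzRingType) (rd : {rmorphism S -> R}).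
Variables (frob : {rmorphism S -> S}) (u E : S) (e r : nat).
Hypothesis frS : frobenius_ring p rd frob u E e.

Local Notation pS := (p%:R : S).
Local Notation phimod := (phimod frob E r).
Local Notation frobcomb := (frobcomb u).

(* As S is free over frob(S) with basis 1, u, ..., u^(p-1), this is the
   injectivity of the linearization of phi. *)
Definition injlin (X : phimod) :=
  forall z : 'I_p -> X, frobcomb z = 0 -> forall i, z i = 0.

Lemma phiZp (X : phimod) n (x : X) : phi X (pS ^+ n *: x) = pS ^+ n *: phi X x.
Proof. by rewrite linearZ /= rmorphXn rmorph_nat. Qed.

Lemma frobcomb_basis (X : phimod) d (b : 'I_d -> X) (c : 'I_p -> 'I_d -> S) :
  frobcomb (fun i => \sum_j c i j *: b j) =
  \sum_j (\sum_(i < p) u ^+ i * frob (c i j)) *: phi X (b j).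
Proof.
under [RHS]eq_bigr do rewrite scaler_suml.
rewrite exchange_big; apply: eq_bigr => i _; rewrite linear_sum scaler_sumr.
by apply: eq_bigr => j _; rewrite linearZ /= scalerA.
Qed.

(** By the height condition the matrix of [phi] over R has a left multiple equal to $u^{er}$, so its
    determinant divides a power of the regular element u. This kills the coefficients $\sum_i
    u^i\,\mathrm{frob}(c_{ij})$, and [fr_inj] then kills each $c_{ij}$ modulo p. *)
Lemma injlin_ptors1 (X : phimod) : FItype p u X -> ptors p X 1 -> injlin X.
Proof.
move=> X_FI X1; have [d [b [a [[span_b rel] a1]]]] := FItype_basis frS X_FI X1.
have {}rel s : \sum_i s i *: b i = 0 <-> forall i, rd (s i) = 0.
  rewrite rel; have aE i : a i = 1%N by apply/eqP; rewrite eqn_leq andbC.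
  split=> ds i; first by apply/(fr_ker frS); have := ds i; rewrite aE.
  by rewrite aE; apply/(fr_ker frS)/ds.
have /choice[A AP] j : exists s, phi X (b j) = \sum_i s i *: b i by apply: span_b.
have phi_comb g : \sum_j g j *: phi X (b j) = \sum_i (\sum_j g j * A j i) *: b i.
  under [RHS]eq_bigr do rewrite scaler_suml.
  rewrite exchange_big; apply: eq_bigr => j _; rewrite AP scaler_sumr.
  by apply: eq_bigr => i _; rewrite scalerA.
have coords (z : 'I_p -> X) : exists c, z = fun i => \sum_j c i j *: b j.
  have /choice[c cP] i : exists s, z i = \sum_j s j *: b j by apply: span_b.
  by exists c; apply/funext.
have /choice[B BP] l : exists g, E ^+ r *: b l = \sum_j g j *: phi X (b j).
  have [z ->] := frobcomb_height frS (b l) X1; have [c ->] := coords z.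
  by rewrite frobcomb_basis; eexists.
pose mA := \matrix_(j, i) rd (A j i); pose mB := \matrix_(l, j) rd (B l j).
have mBA : mB *m mA = (rd u ^+ (e * r))%:M.
  apply/matrixP => l i; rewrite !mxE.
  have /rel/(_ i) : \sum_i (\sum_j B l j * A j i - (l == i)%:R * E ^+ r) *: b i = 0.
    under eq_bigr do rewrite scalerBl.
    rewrite sumrB -phi_comb -BP (bigD1 l) //= eqxx mul1r big1 ?addr0 ?subrr // => j.
    by rewrite eq_sym => /negPf->; rewrite mul0r scale0r.
  rewrite rmorphB rmorphM rmorphXn rmorph_nat (fr_E frS) -exprM => /eqP.
  rewrite subr_eq0 mulr_natl => /eqP <-; rewrite rmorph_sum.
  by apply: eq_bigr => j _; rewrite !mxE rmorphM.
have u_reg n x : rd u ^+ n * x = 0 -> x = 0.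
  by elim: n => [|n IHn]; rewrite ?mul1r // exprS -mulrA => /(fr_ureg frS).
move=> z; have [c ->] := coords z; rewrite frobcomb_basis phi_comb => /rel gA i.
pose g j := \sum_(i < p) u ^+ i * frob (c i j); pose mg := \row_j rd (g j).
have mgA : mg *m mA = 0.
  apply/rowP => l; rewrite !mxE -[RHS](gA l) rmorph_sum.
  by apply: eq_bigr => j _; rewrite !mxE rmorphM.
have g0 j : rd (g j) = 0.
  apply: (u_reg (e * r * d)%N); rewrite exprM.
  (* Multiplying by the adjugate and then by [\det mB] yields $u^{erd} g_j = 0$. *)
  have := congr1 (mulmx^~ (\adj mA)) mgA; rewrite mul0mx -mulmxA mul_mx_adj.
  move=> /(congr1 (fun m => \det mB *: m)); rewrite scaler0 mul_mx_scalar scalerA -det_mulmx.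
  by rewrite mBA det_scalar => /rowP/(_ j); rewrite !mxE.
by apply/rel => j; apply: (fr_inj frS (g0 j)).
Qed.

(* X / gradedker X m is isomorphic to p^m X / p^(m+1) X. *)
Definition gradedker (X : phimod) m : submod X :=
  colonmod (pmod p X m.+1) (pS ^+ m).

Lemma gradedker_phi (X : phimod) m (x : X) :
  gradedker X m x -> gradedker X m (phi X x).
Proof. by move=> [y xE]; exists (phi X y); rewrite -!phiZp xE. Qed.

Lemma fgen_quot (M : lmodType S) (P : submod M) : fgen M -> fgen (quotmod P).
Proof.
move=> [es span_es]; exists [seq quot_pi P x | x <- es] => y.
have [x ->] := quot_pi_surj y.
have : preimmod (quot_pi P) (seqspan [seq quot_pi P x | x <- es]) x; last by [].
by apply: seqspan_min (span_es x) => z es_z; apply/seqspan_mem/map_f.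
Qed.

Lemma ptors_quot (M : lmodType S) (P : submod M) n :
  ptors p M n -> ptors p (quotmod P) n.
Proof.
by move=> Mn y; have [x ->] := quot_pi_surj y; rewrite -linearZ Mn linear0.
Qed.

Lemma pmod_quot (M : lmodType S) (P : submod M) n x :
  pmod p (quotmod P) n (quot_pi P x) <-> addmod P (pmod p M n) x.
Proof.
split=> [[y]|[y Py [z xE]]].
  have [z ->] := quot_pi_surj y; rewrite -linearZ => /quot_pi_eq Pxz.
  by exists (x - pS ^+ n *: z) => //; exists z; rewrite opprB addrC subrK.
exists (quot_pi P z); rewrite -linearZ -xE; apply/quot_pi_eq.
by rewrite opprB addrC subrK.
Qed.

Lemma usat_ptors1 (M : lmodType S) : ptors p M 1 ->
  (forall x : M, u *: x = 0 -> x = 0) -> usat p u M.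
Proof.
move=> M1 Mu [|n] x; first by exists x; rewrite scale1r.
by rewrite /pmod /= exprS => -[y]; rewrite -scalerA M1 => /Mu->; exists 0; rewrite scaler0.
Qed.

(** Absence of u-torsion in the quotient is [usat] at exponent m + 1, applied to $p^m x$. *)
Lemma FItype_gradedker (X : phimod) m :
  FItype p u X -> FItype p u (quotmod (gradedker X m)) /\ ptors p (quotmod (gradedker X m)) 1.
Proof.
case=> Xfg [n Xn] usX; have Q1 : ptors p (quotmod (gradedker X m)) 1.
  move=> y; have [x ->] := quot_pi_surj y; rewrite -linearZ; apply/quot_pi0.
  by exists x; rewrite scalerA -exprD addn1.
split=> //; split; [exact: fgen_quot | by exists 1%N |].
apply: usat_ptors1 => // y; have [x ->] := quot_pi_surj y.
rewrite -linearZ => /quot_pi0 ux; apply/quot_pi0/usX.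
by move: ux; rewrite /gradedker /= scalerA mulrC -scalerA.
Qed.

Lemma injlin_gradedker (X : phimod) m (z : 'I_p -> X) : FItype p u X ->
  gradedker X m (frobcomb z) -> forall i, gradedker X m (z i).
Proof.
move=> /(FItype_gradedker m)[Q_FI Q1] /quot_pi0 z0 i; apply/quot_pi0.
have := @injlin_ptors1 (quot_phimod (@gradedker_phi X m)) Q_FI Q1
  (fun i => quot_proj (@gradedker_phi X m) (z i)).
by rewrite -frobcomb_hom; apply.
Qed.

(** Induction on m: once $z_i = p^m w_i$, injectivity on the graded piece puts the $w_i$ in
    [gradedker X m]. *)
Lemma injlin_pmod (X : phimod) m (z : 'I_p -> X) : FItype p u X ->
  pmod p X m (frobcomb z) -> forall i, pmod p X m (z i).
Proof.
move=> X_FI; elim: m => [|m IHm] in z *.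
  by move=> _ i; exists (z i); rewrite scale1r.
move=> pz i; have /choice[w wP] : forall i, pmod p X m (z i).
  by apply: IHm; have [y ->] := pz; exists (pS *: y); rewrite scalerA -exprSr.
rewrite wP; apply: injlin_gradedker => //.
rewrite /gradedker /= -frobcombZp.
by have -> : (fun i => pS ^+ m *: w i) = z by apply/funext => j; rewrite wP.
Qed.

Lemma FItype_injlin (X : phimod) : FItype p u X -> injlin X.
Proof.
move=> X_FI; have [_ [n Xn] _] := X_FI => z z0 i.
have : pmod p X n (frobcomb z) by rewrite z0; apply: submod0.
by move=> /(injlin_pmod X_FI)/(_ i)[y ->]; apply: Xn.
Qed.

Hypothesis er_lt : (e * r < p - 1)%N.

(** A converse of [FItype_injlin]. The torsion argument is run inside the p-torsion $X[p]$, with B =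
    0 and $D = X[p] \cap p^m X$; general x follow by induction on the power of p killing x. *)
Lemma injlin_FItype (X : phimod) n : injlin X -> fgen X -> ptors p X n ->
  FItype p u X.
Proof.
move=> injX Xfg Xn; split; [by [] | by exists n |].
pose A : submod X := colonmod zeromod pS.
have A_phi x : A x -> A (phi X x).
  by rewrite /A /= -[pS]expr1 -phiZp => ->; rewrite raddf0.
have socle m x : A x -> pmod p X m (u *: x) -> pmod p X m x.
  move=> Ax ux.
  pose D := capmod A (pmod p X m).
  suff DP : forall y, A y -> D (u *: y) -> D y by have [] := DP x Ax (conj (submodZ u Ax) ux).
  apply: (torsion_free_quotient (A := A) (B := zeromod) frS er_lt Xfg Xn) => //.
  - move=> y [Ay [z yE]]; split; first exact: A_phi.
    by exists (phi X z); rewrite yE phiZp.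
  - by move=> y ->; apply: submod0.
  - by move=> y [].
  - by move=> z _; apply: injX.
  move=> x' [px' [y x'E]]; have [z yE] := frobcomb_height frS y Xn.
  exists (fun i => pS ^+ m *: z i); last first.
    by rewrite x'E frobcombZp -yE !scalerA mulrC; apply: subrr.
  (* Since $p x' = 0$, injectivity forces $p^{m+1} z_i = 0$, so $p^m z_i$ stays in A. *)
  have z0 : forall i, pS ^+ m.+1 *: z i = 0.
    apply: (injX (fun i => pS ^+ m.+1 *: z i)); rewrite frobcombZp -yE scalerA mulrC -scalerA.
    by rewrite exprS -scalerA -x'E [X in _ *: X]px' scaler0.
  by move=> i; split; [rewrite /A /= scalerA -exprS z0 | exists (z i)].
suff usX m : forall k (x : X), pS ^+ m *: x = 0 -> pmod p X k (u *: x) -> pmod p X k x.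
  by move=> k x; apply: (usX n).
elim: m => [|m IHm] k x x0 ux.
  by move: x0; rewrite scale1r => ->; apply: submod0.
(* $p^m x$ is killed by p and u times it lies in $p^{k+m}X$; writing it as $p^{k+m}y$ makes $x - p^k
   y$ killed by $p^m$. *)
have [||y yE] := socle (k + m)%N (pS ^+ m *: x); first by rewrite /A /= scalerA -exprS.
  have [w uxE] := ux; exists w.
  by rewrite scalerA mulrC -scalerA uxE scalerA -exprD addnC.
rewrite -(subrK (pS ^+ k *: y) x); apply: submodD; last by exists y.
apply: IHm; first by rewrite scalerBr yE scalerA -exprD addnC subrr.
rewrite scalerBr; apply: submodB => //.
by exists (u *: y); rewrite !scalerA mulrC.
Qed.

(** * Cokernels *)

Section Cokernel.
Variables (X Y : phimod) (f : phihom X Y).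

(** Induction on i shows that $Y/(f(X) + p^i Y)$ has no u-torsion; the step from i to i + 1 takes
    place in $p^iY/p^{i+1}Y$. *)
Lemma FItype_coker : FItype p u X -> FItype p u Y ->
  FItype p u (quotmod (imagemod f)).
Proof.
move=> [Xfg [nX XnX] usX] Y_FI; have [Yfg [n Yn] usY] := Y_FI.
split; [exact: fgen_quot | by exists n; apply: ptors_quot |].
pose Z := imagemod f; pose V i := addmod Z (pmod p Y i).
suff VP i y : V i (u *: y) -> V i y.
  move=> i y'; have [y ->] := quot_pi_surj y'; rewrite -linearZ !pmod_quot; exact: VP.
elim: i y => [|i IHi] y.
  by move=> _; apply: addmodr; exists y; rewrite scale1r.
(* [D] modulo [gradedker Y i] is the trace of $f(X)$ on the graded piece $p^iY/p^{i+1}Y$. *)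
move=> uy; pose D := colonmod (V i.+1) (pS ^+ i).
have Vle x : V i.+1 x -> V i x.
  move=> [z Zz [w xE]]; exists z => //.
  by exists (pS *: w); rewrite xE scalerA -exprSr.
have [z Zz [w yE]] := IHi y (Vle _ uy).
suff DP : forall x, topmod x -> D (u *: x) -> D x.
  rewrite -(subrK z y) yE; apply: submodD; last exact: addmodl.
  apply: DP => //; change (V i.+1 (pS ^+ i *: (u *: w))).
  rewrite scalerA mulrC -scalerA -yE scalerBr.
  apply: submodB => //; apply: addmodl; exact: submodZ.
apply: (torsion_free_quotient (A := topmod) (B := gradedker Y i) frS er_lt Yfg Yn) => //.
- move=> x [_ [x' ->] [x'' xE]].
  exists (f (phi X x')); first by exists (phi X x').
  by exists (phi Y x''); rewrite -!phiZp -xE phihom_comm raddfB.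
- by move=> x _; exists x; rewrite scalerA -exprSr.
- by move=> x Kx; change (V i.+1 (pS ^+ i *: x)); apply: addmodr.
- by move=> t _; apply: injlin_gradedker.
move=> x [_ [x' ->] [x'' xE]].
have [t tE] := frobcomb_height frS x' XnX.
have ftE : E ^+ r *: f x' = frobcomb (fun i => f (t i)).
  by rewrite -frobcomb_hom -tE [RHS]linearZ.
(* $f(x')$ lies in $p^iY$, so injectivity makes its components $f(t_j)$ divisible by $p^i$; the
   quotients $s_j$ give the height condition for [D]. *)
have /choice[s sP] : forall j, pmod p Y i (f (t j)).
  apply: injlin_pmod => //; rewrite -ftE; apply: submodZ.
  exists (x - pS *: x''); rewrite scalerBr scalerA -exprSr -xE opprB addrC subrK //.
exists s.
  move=> j; change (V i.+1 (pS ^+ i *: s j)); rewrite -sP; apply: addmodl.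
  by exists (t j).
exists (E ^+ r *: x''); rewrite scalerBr -frobcombZp.
rewrite (_ : (fun j => _) = (fun j => f (t j))); last by apply/funext => j; rewrite sP.
by rewrite -ftE !scalerA ![_ * E ^+ r]mulrC -!scalerA -scalerBr xE.
Qed.

End Cokernel.

End Injectivity.

(** * The category *)

Section Category.
Variables (p : nat) (S R : comNzRingType) (rd : {rmorphism S -> R}).
Variables (frob : {rmorphism S -> S}) (u E : S) (e r : nat).
Hypothesis frS : frobenius_ring p rd frob u E e.
Hypothesis er_lt : (e * r < p - 1)%N.

Local Notation pS := (p%:R : S).
Local Notation phimod := (phimod frob E r).
Local Notation frobcomb := (frobcomb u).

Lemma frobcomb_seq (X : phimod) (P : submod X) (x : X) (z : 'I_p -> X) :
  (forall i, P (z i)) -> x = frobcomb z ->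
  exists2 t : seq (S * X), (forall sm, sm \in t -> P sm.2) &
    x = \sum_(sm <- t) sm.1 *: phi X sm.2.
Proof.
move=> Pz ->; exists [seq (u ^+ (i : 'I_p), z i) | i <- enum 'I_p].
  by move=> _ /mapP[i _ ->]; apply: Pz.
by rewrite big_map /frobcomb -big_enum.
Qed.

(** * Subobjects and extensions *)

Section SubObject.
Variables (X : phimod) (P : submod X).
Hypothesis P_phi : forall x, P x -> P (phi X x).
Hypothesis P_height : forall x, P x -> exists2 t : seq (S * X),
  (forall sm, sm \in t -> P sm.2) & E ^+ r *: x = \sum_(sm <- t) sm.1 *: phi X sm.2.

Lemma fgen_sub n : fgen X -> ptors p X n -> fgen (submod_type P).
Proof.
move=> Xfg Xn; have [es Pes span_es] := noeth_ptors frS Xfg Xn (P := P) (fun _ _ => I).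
pose es' := [seq insubd (0 : submod_type P) x | x <- es]; exists es' => x.
have [] : pushmod (val : {linear submod_type P -> X}) (seqspan es') (val x).
  apply: seqspan_min (span_es _ (submod_val_in x)) => y es_y.
  exists (insubd (0 : submod_type P) y); first exact/seqspan_mem/map_f.
  by rewrite /= insubdK //; apply/submod_memP/Pes.
by move=> y es'_y /val_inj->.
Qed.

(** [usat] need not pass to submodules, but injectivity of the linearization does, and
    [injlin_FItype] recovers [usat] from it. *)
Lemma sub_FItype : FItype p u X -> FItype p u (sub_phimod P_phi P_height).
Proof.
move=> X_FI; have [Xfg [n Xn] _] := X_FI.
apply: (injlin_FItype frS er_lt (n := n)) => [z z0 i||x].
- apply: val_inj; apply: (FItype_injlin frS X_FI (z := fun i => sub_incl P_phi P_height (z i))).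
  by rewrite -frobcomb_hom z0 linear0.
- exact: fgen_sub Xn.
by apply: val_inj; rewrite /= Xn.
Qed.

End SubObject.

(** Induction on the exponent along $0 \to pX \to X \to X/pX \to 0$. *)
Lemma FItype_Mod_Sinf (X : phimod) : FItype p u X -> Mod_Sinf p X.
Proof.
move=> X_FI; have [_ [n Xn] _] := X_FI; elim: n X X_FI Xn => [|n IHn] X X_FI Xn.
  by apply/Mod_Sinf_base/(FItype_ptors1 frS X_FI)/ptors_le/Xn.
(* At level 0 [gradedker] is just $pX$. *)
pose P := gradedker p X 0; have [Q_FI Q1] := FItype_gradedker 0 X_FI.
have P_height x : P x -> exists2 t : seq (S * X),
    (forall sm, sm \in t -> P sm.2) & E ^+ r *: x = \sum_(sm <- t) sm.1 *: phi X sm.2.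
  move=> [y]; rewrite scale1r => ->; have [z yE] := frobcomb_height frS y Xn.
  apply: (@frobcomb_seq _ _ _ (fun i => pS ^+ 1 *: z i)) => [i|].
    by exists (z i); rewrite scale1r.
  by rewrite frobcombZp -yE !scalerA mulrC.
pose P_phi := @gradedker_phi p S frob E r X 0.
apply: (@Mod_Sinf_ext _ _ _ _ _ _ _ _ (sub_incl P_phi P_height) (quot_proj P_phi)).
- split=> [x y /val_inj//|y|y]; first by have [x ->] := quot_pi_surj y; exists x.
  split=> [/quot_pi0 Py|[x <-]]; first by exists (mk_sub Py).
  exact/quot_pi0/submod_val_in.
- apply: IHn => [|x]; first exact: sub_FItype.
  have [y xE] := submod_val_in x; apply: val_inj => /=.
  by move: xE; rewrite scale1r => ->; rewrite scalerA -exprD addn1 Xn.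
by apply/Mod_Sinf_base/(FItype_ptors1 frS).
Qed.

Lemma ModFI_P (X : phimod) : ModFI_Sinf p X <-> FItype p u X.
Proof.
split=> [[_ /(FItypeP frS)]//|X_FI].
by split; [apply: FItype_Mod_Sinf | apply/(FItypeP frS)].
Qed.

Local Notation C := (ModFI_category frob E r p).

Definition mkob (X : phimod) (X_FI : FItype p u X) : C :=
  exist _ X (iffRL (ModFI_P X) X_FI).

Lemma ob_FItype (X : C) : FItype p u (sval X).
Proof. exact/ModFI_P/(svalP X). Qed.

(** * Kernels, cokernels and biproducts *)

Section Criteria.
Variables X Y Z : C.

Lemma is_kernelP (f : phihom (sval Y) (sval Z)) (i : phihom (sval X) (sval Y)) :
  injective i -> (forall y, f y = 0 <-> exists x, i x = y) ->
  @is_kernel C Y Z X f i.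
Proof.
move=> i_inj iP; split=> [|T g fg0].
  by apply: phihomP => x; apply/iP; exists x.
pose g' : phihom (sval T) (sval Y) := g.
have /choice[h hP] t : exists x, i x = g' t.
  by apply/iP; apply: (congr1 (fun f : phihom _ _ => f t) fg0).
have h_lin : linear h.
  move=> a s t; apply: i_inj; rewrite [RHS]linearP /= !hP.
  exact: linearP.
have h_comm t : h (phi _ t) = phi _ (h t).
  by apply: i_inj; rewrite phihom_comm !hP phihom_comm.
exists (PhiHom h_lin h_comm : @Defs.hom C T X); split; first exact: phihomP.
move=> h' h'P; apply: phihomP => t; apply: i_inj; rewrite hP.
by rewrite /g' -h'P.
Qed.

Lemma is_cokernelP (f : phihom (sval X) (sval Y)) (q : phihom (sval Y) (sval Z)) :
  (forall z, exists y, q y = z) -> (forall y, q y = 0 <-> exists x, f x = y) ->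
  @is_cokernel C X Y Z f q.
Proof.
move=> q_surj qP; split=> [|T g gf0].
  by apply: phihomP => x; apply/qP; exists x.
pose g' : phihom _ _ := g.
have /choice[s sP] := q_surj; pose h z := g' (s z).
have hq y : h (q y) = g' y.
  apply/eqP; rewrite -subr_eq0 -raddfB; apply/eqP.
  have /qP[x <-] : q (s (q y) - y) = 0 by rewrite raddfB /= sP subrr.
  exact: (congr1 (fun f : phihom _ _ => f x) gf0).
have h_lin : linear h.
  move=> a z t; rewrite -(sP z) -(sP t) -(linearP q) /= !hq; exact: linearP.
have h_comm z : h (phi _ z) = phi _ (h z).
  by rewrite -(sP z) -phihom_comm !hq phihom_comm.
exists (PhiHom h_lin h_comm : @Defs.hom C Z T); split; first exact: phihomP.
move=> h' h'P; apply: phihomP => z; rewrite -(sP z) /= hq.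
by rewrite /g' -h'P.
Qed.

End Criteria.

Lemma imagemod_phi (X Y : phimod) (f : phihom X Y) y :
  imagemod f y -> imagemod f (phi Y y).
Proof. by move=> [x ->]; exists (phi X x); rewrite /= phihom_comm. Qed.

Lemma exists_cokernel (X Y : C) (f : phihom (sval X) (sval Y)) :
  exists (Q : C) (q : phihom (sval Y) (sval Q)),
    (forall z, exists y, q y = z) /\ (forall y, q y = 0 <-> exists x, f x = y).
Proof.
have Q_FI := FItype_coker frS er_lt f (ob_FItype X) (ob_FItype Y).
exists (@mkob (quot_phimod (@imagemod_phi _ _ f)) Q_FI), (quot_proj (@imagemod_phi _ _ f)).
split=> [z|y]; first by have [y ->] := quot_pi_surj z; exists y.
by rewrite /= quot_pi0; split=> [[x ->]|[x <-]]; exists x.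
Qed.

Lemma exists_kernel (X Y : C) (f : phihom (sval X) (sval Y)) :
  exists (N : C) (i : phihom (sval N) (sval X)),
    injective i /\ (forall x, f x = 0 <-> exists n, i n = x).
Proof.
pose P := preimmod f zeromod.
have P_phi x : P x -> P (phi _ x) by rewrite /P /= phihom_comm => ->; rewrite raddf0.
have P_height x : P x -> exists2 t : seq (S * sval X),
    (forall sm, sm \in t -> P sm.2) & E ^+ r *: x = \sum_(sm <- t) sm.1 *: phi _ sm.2.
  move=> fx0; have [_ [n Xn] _] := ob_FItype X.
  have [z xE] := frobcomb_height frS x Xn; apply: (frobcomb_seq _ xE).
  (* The components of $E^r x$ stay in the kernel, because f sends them to components of 0 in Y. *)
  apply: (FItype_injlin frS (ob_FItype Y) (z := fun i => f (z i))).
  by rewrite -frobcomb_hom -xE linearZ /= fx0 scaler0.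
exists (mkob (sub_FItype P_phi P_height (ob_FItype X))), (sub_incl P_phi P_height).
split=> [x y /val_inj//|x]; split=> [fx0|[n <-]]; first by exists (@mk_sub _ _ P _ fx0).
exact: (submod_val_in n).
Qed.

Lemma FItype_zero : FItype p u ('rV[S]_0).
Proof.
split; first by exists [::] => x; apply: thinmx0.
  by exists 0%N => x; apply: thinmx0.
by move=> n x _; exists 0; rewrite [x]thinmx0 scaler0.
Qed.

Lemma FItype_prod (M N : lmodType S) : FItype p u M -> FItype p u N ->
  FItype p u (M * N)%type.
Proof.
move=> [[es span_es] [m Mm] usM] [[es' span_es'] [n Nn] usN]; split.
- pose inM x := (x, 0) : M * N; pose inN y := (0, y) : M * N.
  pose gens := [seq inM x | x <- es] ++ [seq inN y | y <- es'].
  have inM_lin : linear inM by move=> a x y; apply: injective_projections; rewrite /= ?scaler0 ?addr0.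
  have inN_lin : linear inN by move=> a x y; apply: injective_projections; rewrite /= ?scaler0 ?addr0.
  pose iM : {linear M -> (M * N)%type} :=
    HB.pack inM (GRing.isLinear.Build S M _ *:%R inM inM_lin).
  pose iN : {linear N -> (M * N)%type} :=
    HB.pack inN (GRing.isLinear.Build S N _ *:%R inN inN_lin).
  exists gens => -[x y].
  have -> : (x, y) = iM x + iN y by congr pair; rewrite ?addr0 ?add0r.
  apply: submodD.
    have : preimmod iM (seqspan gens) x; last by [].
    apply: seqspan_min (span_es x) => z es_z.
    by apply: seqspan_mem; rewrite mem_cat map_f.
  have : preimmod iN (seqspan gens) y; last by [].
  apply: seqspan_min (span_es' y) => z es_z.
  by apply: seqspan_mem; rewrite mem_cat map_f ?orbT.
- exists (m + n)%N => -[x y]; congr pair.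
    exact: (ptors_le (leq_addr n m) Mm).
  exact: (ptors_le (leq_addl m n) Nn).
move=> k [x y] [[x' y'] [xE yE]].
have [x'' ->] := usM k x (ex_intro _ x' xE).
have [y'' ->] := usN k y (ex_intro _ y' yE).
by exists (x'', y'').
Qed.

Definition zero_phimod : phimod.
Proof.
apply: (@PhiMod S frob E r 'rV[S]_0 \0%R) => x.
by exists [::]; rewrite big_nil; apply: thinmx0.
Defined.

Section Product.
Variables X Y : phimod.

Definition prod_phi (z : X * Y) : X * Y := (phi X z.1, phi Y z.2).

Fact prod_phi_semilinear : linear_for (frob \; *:%R) prod_phi.
Proof. by move=> a x y; congr pair; apply: linearP. Qed.

HB.instance Definition _ := GRing.isLinear.Build S (X * Y)%type (X * Y)%type _
  prod_phi prod_phi_semilinear.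

Fact prod_phi_height z : linearization_image prod_phi (E ^+ r *: z).
Proof.
have [s sE] := phi_height z.1; have [t tE] := phi_height z.2.
exists ([seq (sm.1, (sm.2, 0)) | sm <- s] ++ [seq (sm.1, (0, sm.2)) | sm <- t]).
rewrite big_cat !big_map; apply: injective_projections => /=.
  rewrite sE !(raddf_sum fst) /= [X in _ + X]big1 ?addr0 // => sm _.
  by rewrite raddf0 scaler0.
rewrite tE !(raddf_sum snd) /= [X in X + _]big1 ?add0r // => sm _.
by rewrite raddf0 scaler0.
Qed.

Definition prod_phimod : phimod :=
  @PhiMod S frob E r (X * Y)%type prod_phi prod_phi_height.

Definition prod_inl : phihom X prod_phimod.
Proof.
exists (fun x => (x, 0)) => [a x y|x].
  by apply: injective_projections; rewrite /= ?scaler0 ?addr0.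
by apply: injective_projections; rewrite /= ?raddf0.
Defined.

Definition prod_inr : phihom Y prod_phimod.
Proof.
exists (fun y => (0, y)) => [a x y|y].
  by apply: injective_projections; rewrite /= ?scaler0 ?addr0.
by apply: injective_projections; rewrite /= ?raddf0.
Defined.

Definition prod_fst : phihom prod_phimod X.
Proof. by exists fst. Defined.

Definition prod_snd : phihom prod_phimod Y.
Proof. by exists snd. Defined.

End Product.

Theorem ModFI_abelian : abelian_category C.
Proof.
split.
- exists (@mkob zero_phimod FItype_zero) => X; split=> f g; apply: phihomP => x.
    by rewrite [LHS]thinmx0 [RHS]thinmx0.
  by rewrite [x]thinmx0 !raddf0.
- move=> X Y.
  pose B := @mkob (prod_phimod (sval X) (sval Y)) (FItype_prod (ob_FItype X) (ob_FItype Y)).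
  exists B, (prod_inl _ _), (prod_inr _ _), (prod_fst _ _), (prod_snd _ _).
  split; apply: phihomP => // z.
  by apply: injective_projections; rewrite /= ?addr0 ?add0r.
- move=> X Y f; have [N [i [i_inj iP]]] := exists_kernel f.
  by exists N, i; apply: is_kernelP.
- move=> X Y f; have [Q [q [q_surj qP]]] := exists_cokernel f.
  by exists Q, q; apply: is_cokernelP.
- move=> X Y f f_mono; have [N [i [i_inj iP]]] := exists_kernel f.
  (* The kernel inclusion of a monomorphism is zero, so f is injective and is the kernel of its
     cokernel. *)
  have f_inj : injective (f : phihom _ _).
    move=> x y fxy; apply/eqP; rewrite -subr_eq0; apply/eqP.
    have /iP[n <-] : (f : phihom _ _) (x - y) = 0 by rewrite raddfB /= fxy subrr.
    have /(congr1 (fun h : phihom _ _ => h n)) : i = (0 : @Defs.hom C N X).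
      apply: f_mono; apply: phihomP => m /=; rewrite raddf0; apply/iP.
      by exists m.
    by [].
  have [Q [q [q_surj qP]]] := exists_cokernel f.
  by exists Q, q; apply: is_kernelP.
- move=> X Y f f_epi; have [Q [q [q_surj qP]]] := exists_cokernel f.
  (* Dually, the cokernel projection is zero, so f is surjective and is the cokernel of its
     kernel. *)
  have f_surj y : exists x, (f : phihom _ _) x = y.
    apply/qP; have /(congr1 (fun h : phihom _ _ => h y)) : q = (0 : @Defs.hom C Y Q).
      by apply: f_epi; apply: phihomP => x /=; apply/qP; exists x.
    by [].
  have [N [i [i_inj iP]]] := exists_kernel f.
  by exists N, i; apply: is_cokernelP.
Qed.

End Category.

(** * Power series over the Witt ring *)

Section PowerSeries.
Variable A : comNzRingType.
Implicit Types f g : fps A.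

Definition fpsX : fps A := FPS (fun n => (n == 1%N)%:R).

Lemma fcoef_fpsX_mul f n :
  fcoef (fpsX * f) n = if n is m.+1 then fcoef f m else 0.
Proof.
case: n => [|n]; rewrite [LHS]big_ord_recl /= mul0r add0r ?big_ord0 //.
rewrite big_ord_recl /= mul1r subn1 big1 ?addr0 // => i _.
by rewrite mul0r.
Qed.

Lemma fcoef_fpsXn_mul m f n :
  fcoef (fpsX ^+ m * f) n = if (m <= n)%N then fcoef f (n - m) else 0.
Proof.
elim: m n => [|m IHm] n; first by rewrite mul1r subn0.
by rewrite exprS -mulrA fcoef_fpsX_mul; case: n.
Qed.

Lemma fcoef_sum (I : Type) (s : seq I) (F : I -> fps A) n :
  fcoef (\sum_(i <- s) F i) n = \sum_(i <- s) fcoef (F i) n.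
Proof. by elim/big_rec2: _ => // i x f _ <-. Qed.

Lemma fcoef_natmul m f n : fcoef (m%:R * f) n = m%:R * fcoef f n.
Proof.
rewrite !mulr_natl; elim: m => [|m IHm]; first by rewrite !mulr0n.
by rewrite !mulrS -IHm.
Qed.

Lemma divides_fcoef m f :
  divides m%:R f <-> forall n, divides m%:R (fcoef f n).
Proof.
split=> [[g ->] n|/choice[g gP]]; first by exists (fcoef g n); rewrite fcoef_natmul.
by exists (FPS g); apply: fpsP => n; rewrite fcoef_natmul.
Qed.

End PowerSeries.

Section PowerSeriesInverse.
Variables (k : fieldType) (f : fps k).

(** The first n coefficients of $1/f$: that of index m solves $\sum_{i \le m} g_i f_{m-i} =
    \delta_{m,0}$ for $g_m$. *)
Fixpoint fps_inv_seq n : seq k :=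
  if n is m.+1 then
    let s := fps_inv_seq m in
    rcons s ((fcoef f 0)^-1 * ((m == 0%N)%:R - \sum_(i < m) s`_i * fcoef f (m - i)))
  else [::].

Lemma fps_inv_exists : fcoef f 0 != 0 -> exists g, f * g = 1.
Proof.
move=> f0; have size_inv n : size (fps_inv_seq n) = n.
  by elim: n => //= n IHn; rewrite size_rcons IHn.
pose g := FPS (fun n => (fps_inv_seq n.+1)`_n).
have nth_inv m i : (i < m)%N -> (fps_inv_seq m)`_i = fcoef g i.
  elim: m => // m IHm; rewrite ltnS leq_eqVlt => /predU1P[->//|lt_im].
  by rewrite /= nth_rcons size_inv lt_im IHm.
exists g; rewrite mulrC; apply: fpsP => n; rewrite [LHS]big_ord_recr /= subnn.
rewrite nth_rcons size_inv ltnn eqxx mulrC mulVKf //.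
rewrite (eq_bigr (fun i : 'I_n => (fps_inv_seq n)`_i * fcoef f (n - i))) => [|i _].
  by rewrite addrC subrK.
by rewrite nth_inv.
Qed.

End PowerSeriesInverse.

Section Reduction.
Variables (W : comNzRingType) (k : fieldType) (red : {rmorphism W -> k}).

Definition fps_red (f : fps W) : fps k := FPS (fun n => red (fcoef f n)).

Fact fps_red_is_zmod_morphism : zmod_morphism fps_red.
Proof. by move=> f g; apply: fpsP => n /=; rewrite rmorphB. Qed.

Fact fps_red_is_monoid_morphism : monoid_morphism fps_red.
Proof.
split=> [|f g]; apply: fpsP => n /=; first by rewrite rmorph_nat.
by rewrite rmorph_sum; apply: eq_bigr => i _; rewrite rmorphM.
Qed.

HB.instance Definition _ := GRing.isZmodMorphism.Build (fps W) (fps k) fps_red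
  fps_red_is_zmod_morphism.
HB.instance Definition _ := GRing.isMonoidMorphism.Build (fps W) (fps k) fps_red
  fps_red_is_monoid_morphism.

Lemma fcoef_red f n : fcoef (fps_red f) n = red (fcoef f n).
Proof. by []. Qed.

Lemma fps_redX : fps_red (fpsX W) = fpsX k.
Proof. by apply: fpsP => n /=; rewrite rmorph_nat. Qed.

End Reduction.

(** Only i = m mod p contributes, as summand i involves only exponents of u congruent to i modulo
    p. *)
Lemma fcoef_frob_sum p (W : comNzRingType) (sigma : {rmorphism W -> W})
    (p_gt0 : (0 < p)%N) (c : 'I_p -> fps W) m :
  fcoef (\sum_(i < p) fpsX W ^+ i * fps_frob p sigma (c i)) m =
  sigma (fcoef (c (Ordinal (ltn_pmod m p_gt0))) (m %/ p)).
Proof.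
rewrite fcoef_sum (bigD1 (Ordinal (ltn_pmod m p_gt0))) // big1 => [|i ne_i].
  rewrite fcoef_fpsXn_mul /= leq_mod addr0.
  have -> : (m - m %% p = m %/ p * p)%N by rewrite {1}(divn_eq m p) addnK.
  by rewrite dvdn_mull // mulnK.
rewrite fcoef_fpsXn_mul; case: ifP => //= le_im; case: ifP => // dv_p.
case/eqP: ne_i; apply: val_inj => /=.
by move: dv_p; rewrite -eqn_mod_dvd // => /eqP ->; rewrite modn_small.
Qed.

Lemma witt_frobenius_ring p (p_prime : prime p) (k : fieldType)
    (k_perfect : perfect_field p k) (W : comNzRingType) (red : {rmorphism W -> k})
    (W_witt : is_witt_ring p red) (sigma : {rmorphism W -> W})
    (sigma_frob : is_witt_frobenius p red sigma) (E : {poly W}) :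
  is_eisenstein p E ->
  frobenius_ring p (fps_red red) (fps_frob p sigma) (fpsX W) (fps_of_poly E)
    (size E).-1.
Proof.
move=> E_eis; have p_gt0 := prime_gt0 p_prime.
have redS s : fps_red red s = 0 <-> divides p%:R s.
  rewrite divides_fcoef; split=> [s0 n|ds].
    by apply/(witt_red_ker W_witt); have := congr1 (fun f : fps _ => fcoef f n) s0.
  by apply: fpsP => n; apply/(witt_red_ker W_witt).
split.
- exact: redS.
- move=> s s_nz.
  have exn : exists n, red (fcoef s n) != 0.
    apply: contrapT => s0; apply: s_nz; apply: fpsP => n /=.
    by apply: contrapT => sn; apply: s0; exists n; apply/eqP.
  (* o is the index of the first coefficient nonzero in k, so the shifted series t has invertible
     constant term in k. *)
  case: (ex_minnP exn) => o so_nz min_o.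
  pose t := FPS (fun n => fcoef s (n + o)).
  have [g tg] : exists g, fps_red red t * g = 1 by apply: fps_inv_exists.
  have /choice[w wP] n : exists w, red w = fcoef g n by apply: witt_red_surj W_witt _.
  exists o, t, (FPS w); split.
    apply: fpsP => n; rewrite !fcoef_red fcoef_fpsXn_mul; case: leqP => [le_on|lt_no] /=.
      by rewrite subnK.
    by rewrite rmorph0; apply/eqP; apply: contraTT lt_no => /min_o; rewrite -leqNgt.
  by rewrite rmorphM -tg; congr (_ * _); apply: fpsP => n; apply: wP.
- move=> x; rewrite /= fps_redX => Xx; apply: fpsP => n.
  by have := congr1 (fun f : fps _ => fcoef f n.+1) Xx; rewrite fcoef_fpsX_mul.
- move=> n s; rewrite -natrX !divides_fcoef => ds m.
  by have := ds m.+1; rewrite fcoef_fpsX_mul.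
- apply: fpsP => n; rewrite -[_ ^+ p]mulr1 fcoef_fpsXn_mul /=.
  case: (boolP (p %| n)%N) => [/dvdnP[q ->]|pn]; last first.
    case: leqP => // le_pn; case: eqP => // np0.
    by case/negP: pn; rewrite -(subnK le_pn) np0 dvdnn.
  rewrite mulnK // rmorph_nat -[X in (X <= _)%N]mul1n -[X in (_ - X)%N]mul1n.
  by rewrite leq_pmul2r // -mulnBl muln_eq0 (gtn_eqF p_gt0) orbF; case: q => [|[|q]].
- move=> s; have [_ perf] := k_perfect.
  (* Perfectness of k supplies p-th roots of the reduced coefficients; the root at index $np + i$
     becomes coefficient n of component i. *)
  have /choice[w wP] m : exists w, red w ^+ p = red (fcoef s m).
    by have [y <-] := perf (red (fcoef s m)); have [x <-] := witt_red_surj W_witt y; exists x.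
  exists (fun i => FPS (fun n => w (n * p + i)%N)); apply: fpsP => m.
  by rewrite !fcoef_red fcoef_frob_sum /= sigma_frob -divn_eq.
(* Coefficient $np + i$ of the sum reduces to the p-th power of the reduction of coefficient n of
   [c i]. *)
- move=> c c0 i; apply: fpsP => n.
  have := congr1 (fun f : fps _ => fcoef f (n * p + i)%N) c0.
  rewrite fcoef_red fcoef_frob_sum sigma_frob => /eqP; rewrite expf_eq0 => /andP[_ /eqP].
  rewrite divnMDl // divn_small // addn0 => cn0; apply: etrans cn0.
  rewrite fcoef_red; congr (red (fcoef (c _) n)).
  by apply: val_inj; rewrite /= modnMDl modn_small.
(* An Eisenstein polynomial reduces to $u^{\deg E}$ modulo p. *)
rewrite /= fps_redX; apply: fpsP => n; rewrite fcoef_red -[_ ^+ _.-1]mulr1 fcoef_fpsXn_mul /=.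
case: ltngtP => [lt_dn|lt_nd|<-].
- rewrite nth_default ?rmorph0; first by rewrite -(subnSK lt_dn).
  by rewrite -(prednK (ltnW (eisenstein_size E_eis))).
- exact/(witt_red_ker W_witt)/eisenstein_coef.
by rewrite subnn -/(lead_coef E) (monicP (eisenstein_monic E_eis)) rmorph1.
Qed.

(** * Valuations and the degree of E *)

Section Ramification.
Variables (K : fieldType) (v : discrete_valuation K).

Lemma vgeD n x y : vge v n x -> vge v n y -> vge v n (x + y).
Proof.
rewrite /vge; have [->|x0] := eqVneq x 0; first by rewrite add0r.
have [->|y0] := eqVneq y 0; first by rewrite addr0 (negPf x0).
have [//|xy0] := eqVneq (x + y) 0; move=> /= vx vy.
by apply: le_trans (dvD v x0 y0 xy0); rewrite le_min vx.
Qed.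

Lemma vgeM m n x y : vge v m x -> vge v n y -> vge v (m + n) (x * y).
Proof.
rewrite /vge; have [->|x0] := eqVneq x 0; first by rewrite mul0r eqxx.
have [->|y0] := eqVneq y 0; first by rewrite mulr0 eqxx.
by move=> /= vx vy; rewrite dvM // lerD ?orbT.
Qed.

Lemma vgeN n x : vge v n x -> vge v n (- x).
Proof.
rewrite /vge oppr_eq0; have [//|x0] := eqVneq x 0 => /= vx.
by rewrite -mulN1r dvM ?oppr_eq0 ?oner_eq0 // dvN1 add0r.
Qed.

Lemma vge_le m n x : m <= n -> vge v n x -> vge v m x.
Proof. by rewrite /vge => le_mn /orP[->//|/(le_trans le_mn)->]; rewrite orbT. Qed.

Lemma vge_dv n x : v x = n -> vge v n x.
Proof. by move=> vx; rewrite /vge vx lexx orbT. Qed.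

Lemma vge_sum n (I : Type) (s : seq I) (F : I -> K) :
  (forall i, vge v n (F i)) -> vge v n (\sum_(i <- s) F i).
Proof.
by move=> vF; elim/big_ind: _ => [|x y|//]; [rewrite /vge eqxx | apply: vgeD].
Qed.

Lemma vge_exact n x : x != 0 -> v x = n -> ~~ vge v (n + 1) x.
Proof. by move=> x0 vx; rewrite /vge (negPf x0) /= vx -ltNge ltrDl. Qed.

Lemma dvX x n : x != 0 -> v (x ^+ n) = v x *+ n.
Proof.
move=> x0; elim: n => [|n IHn]; first by rewrite expr0 mulr0n dv1.
by rewrite exprS dvM ?expf_neq0 // IHn mulrS.
Qed.

End Ramification.

(* Among the terms of E(pi) = 0 only the constant one, of valuation v(p), and
   the leading one, of valuation deg E, can have minimal valuation. *)
Lemma eisenstein_degree p (p_prime : prime p) (k K : fieldType)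
    (v : discrete_valuation K) (K_char0 : [pchar K] =i pred0)
    (res : {rmorphism integers v -> k}) (res_K : is_residue_map res)
    (e : nat) (e_ram : v p%:R = e%:Z)
    (W : comNzRingType) (red : {rmorphism W -> k}) (W_witt : is_witt_ring p red)
    (iota : {rmorphism W -> integers v}) (iota_red : forall x, res (iota x) = red x)
    (pi : integers v) (pi_unif : uniformizer pi)
    (E : {poly W}) (E_eis : is_eisenstein p E) (E_pi : root (map_poly iota E) pi) :
  (size E).-1 = e.
Proof.
have [pi0 vpi] := pi_unif; set d := (size E).-1.
have size_E : size E = d.+1 by rewrite prednK // (ltnW (eisenstein_size E_eis)).
have d_gt0 : (0 < d)%N by have := eisenstein_size E_eis; rewrite size_E.
have p0 : (p%:R : K) != 0.
  by apply/eqP => p0; have := K_char0 p; rewrite !inE p_prime p0 eqxx.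
have vp := vge_dv e_ram.
have vint (x : integers v) : vge v 0 (integer_val x).
  by have := integer_valP x; rewrite unfold_in.
have iotap c : integer_val (iota (p%:R * c)) = p%:R * integer_val (iota c).
  by rewrite rmorphM rmorph_nat [LHS](rmorphM \val) rmorph_nat.
pose x := integer_val pi.
have sumE : \sum_(i < d.+1) integer_val (iota E`_i) * x ^+ i = 0.
  move: E_pi => /rootP; rewrite (@horner_coef_wide _ d.+1); last first.
    by rewrite -size_E; apply: size_poly.
  move=> /(congr1 \val); rewrite rmorph_sum rmorph0 => s0; rewrite -[RHS]s0.
  by apply: eq_bigr => i _; rewrite coef_map rmorphM rmorphXn.
move: sumE; rewrite big_ord_recr /=.
rewrite (_ : E`_d = 1); last exact: (monicP (eisenstein_monic E_eis)).
rewrite rmorph1 mul1r -(big_mkord xpredT (fun i => integer_val (iota E`_i) * x ^+ i)).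
rewrite big_ltn // expr0 mulr1 big_add1 big_mkord.
set b := integer_val _; set c := \sum_(i < _) _ => sumE.
(* Each middle term gains e from the factor p of its coefficient and at least 1 from the
   uniformizer. *)
have vc : vge v (e%:Z + 1) c.
  apply: vge_sum => i.
  have [|y ->] := eisenstein_coef E_eis (i := i.+1); first by rewrite -/d -ltn_predRL.
  have := vgeM (vgeM vp (vint (iota y))) (vgeM (vge_dv vpi) (vint (pi ^+ i))).
  by rewrite !addr0 iotap exprS [integer_val (pi ^+ i)](rmorphXn \val).
have [y E0] := eisenstein_coef E_eis d_gt0.
(* If y reduced to 0 in k it would be divisible by p in W, and $p^2$ would divide $E_0$. *)
have y_nz : ~ vge v 1 (integer_val (iota y)).
  move/(proj2 res_K); rewrite iota_red => /(witt_red_ker W_witt)[z yE].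
  by case: (eisenstein_coef0 E_eis); exists z; rewrite E0 yE mulrA.
have [b0 vb] : b != 0 /\ v b = e%:Z.
  move/negP: y_nz; rewrite /vge negb_or -ltNge => /andP[y0 vy_lt].
  have := vint (iota y); rewrite /vge (negPf y0) /= => vy_ge.
  rewrite /b E0 iotap mulf_neq0 // dvM // e_ram; split=> //.
  by rewrite (_ : v _ = 0) ?addr0 //; apply/eqP; rewrite eq_le vy_ge -ltzD1 add0r vy_lt.
have vxd : v (x ^+ d) = d%:Z by rewrite dvX // vpi natz.
(* For d < e the leading term, for d > e the constant term, would be minus a sum of terms of
   strictly larger valuation. *)
case: (ltngtP d e) => // [lt_de|lt_ed].
  have := vge_exact (expf_neq0 d pi0) vxd; case/negP.
  have -> : x ^+ d = - (b + c) by apply/eqP; rewrite -addr_eq0 addrC sumE.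
  apply/vgeN/vgeD.
    by apply: vge_le (vge_dv vb); rewrite lez_nat addn1.
  by apply: vge_le vc; rewrite lerD2r lez_nat ltnW.
have := vge_exact b0 vb; case/negP.
have -> : b = - (c + x ^+ d) by apply/eqP; rewrite -addr_eq0 addrA sumE.
apply/vgeN/vgeD => //.
by apply: vge_le (vge_dv vxd); rewrite lez_nat addn1.
Qed.

Theorem theorem7p19 (p : nat) (p_prime : prime p)
  (k : fieldType) (k_perfect : perfect_field p k)
  (* complete of characteristic 0 with residue characteristic p, so that K
     contains Q_p *)
  (K : fieldType) (v : discrete_valuation K)
  (K_complete : complete_valuation v) (K_char0 : [pchar K] =i pred0)
  (res : {rmorphism integers v -> k}) (res_K : is_residue_map res)
  (e : nat) (e_ram : v p%:R = e%:Z)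
  (* W = W(k), and iota is its canonical map to O_K *)
  (W : comNzRingType) (red : {rmorphism W -> k}) (W_witt : is_witt_ring p red)
  (sigma : {rmorphism W -> W}) (sigma_frob : is_witt_frobenius p red sigma)
  (iota : {rmorphism W -> integers v}) (iota_red : forall x, res (iota x) = red x)
  (pi : integers v) (pi_unif : uniformizer pi)
  (E : {poly W}) (E_eis : is_eisenstein p E) (E_pi : root (map_poly iota E) pi)
  (r : nat) (er_lt : (e * r < p - 1)%N) :
  abelian_category (ModFI_category (fps_frob p sigma) (fps_of_poly E) r p).
Proof.
have dE := eisenstein_degree p_prime K_char0 res_K e_ram W_witt iota_red pi_unif E_eis E_pi.
apply: (ModFI_abelian (witt_frobenius_ring p_prime k_perfect W_witt sigma_frob E_eis)).
by rewrite dE.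
Qed.
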